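(* Let $\Lambda$ be a finite, strongly connected $k$-graph and let $\delta\in(0,1)$ be such that $w_\delta$ is a weight satisfying $w_\delta(\lambda)=\operatorname{diam}[\lambda]$ for all $\lambda\in F\mathcal B_\Lambda$. Then the ultrametric Cantor set $(X_{\mathcal B_\Lambda},d_\delta)$ is $\zeta$-regular in the sense of Pearson and Bellissard.
   Context: $\mathbb N=\{0,1,2,\dots\}$. A $k$-graph ($k\ge 1$) is a countable small category $\Lambda$ with a functor $d:\Lambda\to\mathbb N^k$ ($\mathbb N^k$ viewed as a one-object category under addition) such that whenever $d(\lambda)=m+n$ there are unique $\mu,\nu\in\Lambda$ with $d(\mu)=m$, $d(\nu)=n$, $\lambda=\mu\nu$. Here $\lambda\in\Lambda$ means $\lambda$ is a morphism; $\Lambda^n=d^{-1}(n)$; $\Lambda^0$ is identified with the objects (vertices); $r,s:\Lambda\to\Lambda^0$ are range and source. $\Lambda$ is finite if every $\Lambda^n$ is finite, and strongly connected if for all $v,w\in\Lambda^0$ there is $\lambda\in\Lambda$ with $r(\lambda)=v$, $s(\lambda)=w$. With $e_i$ the standard basis of $\mathbb N^k$, the adjacency matrices are $A_i(v,w)=\#\{\lambda\in\Lambda^{e_i}: r(\lambda)=v,\ s(\lambda)=w\}$; $\rho_i$ is the spectral radius of $A_i$. For $\Lambda$ finite and strongly connected, $x^\Lambda\in(0,\infty)^{\Lambda^0}$ is the unique positive vector with $\sum_v x^\Lambda_v=1$ and $A_ix^\Lambda=\rho_ix^\Lambda$ for $1\le i\le k$. The stationary $k$-Bratteli diagram $\mathcal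 B_\Lambda$ has vertex set $\bigsqcup_{n\ge0}\mathcal V_n$, each $\mathcal V_n$ a copy of $\Lambda^0$, and edge set $\bigsqcup_{n\ge1}\mathcal E_n$, where for $n\equiv i \pmod k$, $1\le i\le k$, $\mathcal E_n$ contains exactly $A_i(p,q)$ edges with range $p\in\mathcal V_{n-1}$ and source $q\in\mathcal V_n$. $F\mathcal B_\Lambda$ is the set of finite paths $\eta=\eta_1\cdots\eta_m$ ($\eta_i\in\mathcal E_i$, $s(\eta_i)=r(\eta_{i+1})$), of length $|\eta|=m$; vertices in $\mathcal V_0$ are the paths of length $0$. $X_{\mathcal B_\Lambda}$ is the set of infinite paths $(x_n)_{n\ge1}$, $x_n\in\mathcal E_n$, $s(x_n)=r(x_{n+1})$, with the topology generated by the cylinder sets $[\lambda]$ = set of infinite paths with initial segment $\lambda\in F\mathcal B_\Lambda$. A weight is a function $w:F\mathcal B_\Lambda\to(0,\infty)$ with $\sum_{v\in\mathcal V_0}w(v)\le1$, $\lim_{n}\sup\{w(\lambda):|\lambda|=n\}=0$, and $w(\lambda)<w(\eta)$ whenever $\eta$ is a proper initial segment of $\lambda$. For $\delta\in(0,1)$ and $|\eta|=qk+t$ with $q\in\mathbb N$, $0\le t\le k-1$, $$w_\delta(\eta)=\big(\rho_1^{q+1}\cdots\rho_t^{q+1}\rho_{t+1}^q\cdots\rho_k^q\big)^{-1/\delta}x^\Lambda_{s(\eta)}.$$ For $x\ne y$ in $X_{\mathcal B_\Lambda}$, $x\wedge y$ is the longest common initial segment in $F\mathcal B_\Lambda$ ($\emptyset$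 if $r(x)\neq r(y)$); $d_\delta(x,y)=w_\delta(x\wedge y)$ if $x\wedge y\ne\emptyset$, $d_\delta(x,y)=1$ if $x\wedge y=\emptyset$, and $d_\delta(x,x)=0$; $\operatorname{diam}[\lambda]=\sup\{d_\delta(x,y):x,y\in[\lambda]\}$. Under the hypotheses of the claim, $X_{\mathcal B_\Lambda}$ is a Cantor set and $d_\delta$ is an ultrametric inducing its topology. A choice function is a map $\tau=(\tau_+,\tau_-):F\mathcal B_\Lambda\to X_{\mathcal B_\Lambda}\times X_{\mathcal B_\Lambda}$ with $\tau(\gamma)\in[\gamma]\times[\gamma]$ and $d_\delta(\tau_+(\gamma),\tau_-(\gamma))=\operatorname{diam}[\gamma]$. On $\ell^2(F\mathcal B_\Lambda,\mathbb C^2)$ put $\pi_\tau(f)=\bigoplus_\gamma\mathrm{diag}(f(\tau_+(\gamma)),f(\tau_-(\gamma)))$ for $f\in C(X_{\mathcal B_\Lambda})$ and $D=\bigoplus_\gamma\frac1{\operatorname{diam}[\gamma]}\begin{pmatrix}0&1\\1&0\end{pmatrix}$. The zeta function is $\zeta_\delta(s)=\frac12\operatorname{Tr}(|D|^{-s})$. $(X_{\mathcal B_\Lambda},d_\delta)$ is $\zeta$-regular if $\zeta_\delta$ has an abscissa of convergence $s_0\in(0,\infty)$ (i.e. $s_0=\inf\{s>0:\zeta_\delta(s)<\infty\}$) and, for every choice function $\tau$ and every $f\in C(X_{\mathcal B_\Lambda})$, the limit $$\lim_{s\searrow s_0}\frac{\operatorname{Tr}(|D|^{-s}\pi_\tau(f))}{\operatorname{Tr}(|D|^{-s})}$$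 exists. *)

(* Defs.v *)
From HB Require Import structures.
From mathcomp Require Import all_boot all_order all_algebra.
From mathcomp Require Import finmap spectral complex.
From mathcomp Require Import all_classical all_reals all_analysis.
From mathcomp Require summability.

Set Implicit Arguments.
Unset Strict Implicit.
Unset Printing Implicit Defensive.

Import Order.TTheory GRing.Theory Num.Theory.
Import numFieldNormedType.Exports.

Local Open Scope classical_set_scope.
Local Open Scope ring_scope.

(** A [k]-graph with object type [V].  Composition is a total function, but it
    is constrained only on composable pairs: [cmp l m] is meaningful when
    [src l = rng m].  Objects are kept apart from morphisms; [idm] embeds them
    as the morphisms of degree 0. *)
Record kgraph (k : nat) (V : Type) := KGraph {
  mor : countType;
  deg : mor -> {ffun 'I_k -> nat};
  rng : mor -> V;
  src : mor -> V;
  idm : V -> mor;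
  cmp : mor -> mor -> mor;
  rng_idm : forall v, rng (idm v) = v;
  src_idm : forall v, src (idm v) = v;
  rng_cmp : forall l m, src l = rng m -> rng (cmp l m) = rng l;
  src_cmp : forall l m, src l = rng m -> src (cmp l m) = src m;
  cmpA : forall l m n, src l = rng m -> src m = rng n ->
    cmp l (cmp m n) = cmp (cmp l m) n;
  cmp_idml : forall l, cmp (idm (rng l)) l = l;
  cmp_idmr : forall l, cmp l (idm (src l)) = l;
  deg_idm : forall v, deg (idm v) = 0;
  deg_cmp : forall l m, src l = rng m -> deg (cmp l m) = deg l + deg m;
  unique_factorization : forall l m n, deg l = m + n ->
    exists! p : mor * mor,
      [/\ deg p.1 = m, deg p.2 = n, src p.1 = rng p.2 & l = cmp p.1 p.2]
}.

Definition finite_kgraph k V (L : kgraph k V) :=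
  forall n, finite_set [set l : mor L | deg l = n].

Definition strongly_connected k V (L : kgraph k V) :=
  forall v w : V, exists l : mor L, rng l = v /\ src l = w.

(** Generators of [N^k] and adjacency matrices are indexed from 0, by natural
    numbers; only the indices [i < k] are meaningful. *)
Definition unit_deg k (i : nat) : {ffun 'I_k -> nat} :=
  [ffun j : 'I_k => nat_of_bool (j == i :> nat)].

Definition adj k V (L : kgraph k V) (i : nat) (v w : V) : nat :=
  #|` fset_set
        [set l : mor L | [/\ deg l = unit_deg k i, rng l = v & src l = w]]|.

Definition spectral_radius (R : realType) n (M : 'M[R[i]]_n) : R :=
  sup [set Normc.normc a | a in [set a : R[i] | eigenvalue M a]].

Definition rho (R : realType) k (V : finType) (L : kgraph k V) (i : nat) : R :=
  spectral_radius
    (\matrix_(p < #|V|, q < #|V|) (adj L i (enum_val p) (enum_val q))%:R).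

Definition perron_frobenius (R : realType) k (V : finType) (L : kgraph k V)
    (x : V -> R) :=
  [/\ forall v, 0 < x v,
      \sum_v x v = 1 &
      forall (i : 'I_k) v, \sum_w (adj L i v w)%:R * x w = rho R L i * x v].

(** Bratteli diagrams all of whose levels are copies of [V].  The level-[n]
    edges join [V_n] to [V_n.+1] (they form [E_(n+1)]), and [A n p q] is the
    number of those with range [p] and source [q].  The edge [(p, q, j)] is the
    [j]-th such edge; it exists iff [j < A n p q]. *)
Definition edge (V : Type) : Type := (V * V * nat)%type.
Definition erng V (e : edge V) : V := e.1.1.
Definition esrc V (e : edge V) : V := e.1.2.

Definition is_edge V (A : nat -> V -> V -> nat) n (e : edge V) : bool :=
  (e.2 < A n (erng e) (esrc e))%N.

Fixpoint is_path (V : eqType) (A : nat -> V -> V -> nat) n (v : V)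
    (s : seq (edge V)) : bool :=
  if s is e :: s' then
    [&& erng e == v, is_edge A n e & is_path A n.+1 (esrc e) s']
  else true.

(** A finite path is a range in [V_0] followed by a list of edges, so that the
    vertices of [V_0] are the paths of length 0. *)
Definition fin_path (V : finType) (A : nat -> V -> V -> nat) : Type :=
  {p : V * seq (edge V) | is_path A 0 p.1 p.2}.
HB.instance Definition _ (V : finType) (A : nat -> V -> V -> nat) :=
  Countable.on (fin_path A).

Definition plen (V : finType) (A : nat -> V -> V -> nat) (l : fin_path A) : nat :=
  size (val l).2.

Definition psrc (V : finType) (A : nat -> V -> V -> nat) (l : fin_path A) : V :=
  last (val l).1 [seq esrc e | e <- (val l).2].

Definition vpath (V : finType) (A : nat -> V -> V -> nat) (v : V) : fin_path A :=
  exist (fun p : V * seq (edge V) => is_path A 0 p.1 p.2) (v, [::]) isT.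

Definition proper_prefix (V : finType) (A : nat -> V -> V -> nat)
    (eta l : fin_path A) : bool :=
  [&& (val eta).1 == (val l).1, prefix (val eta).2 (val l).2 & eta != l].

Record inf_path (V : finType) (A : nat -> V -> V -> nat) := InfPath {
  inf_path_edge :> nat -> edge V;
  inf_pathP : forall n, is_edge A n (inf_path_edge n) /\
    esrc (inf_path_edge n) = erng (inf_path_edge n.+1)
}.
HB.instance Definition _ (V : finType) (A : nat -> V -> V -> nat) :=
  gen_eqMixin (inf_path A).
HB.instance Definition _ (V : finType) (A : nat -> V -> V -> nat) :=
  gen_choiceMixin (inf_path A).

Definition cylinder (V : finType) (A : nat -> V -> V -> nat) (l : fin_path A) :
    set (inf_path A) :=
  [set x | (erng (x 0%N), mkseq x (plen l)) = val l].

HB.instance Definition _ (V : finType) (A : nat -> V -> V -> nat) :=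
  isSubBaseTopological.Build (inf_path A) (range (@cylinder V A)) id.

Definition is_weight (R : realType) (V : finType) (A : nat -> V -> V -> nat)
    (w : fin_path A -> R) :=
  [/\ forall l, 0 < w l,
      \sum_v w (vpath A v) <= 1,
      (fun n => sup [set w l | l in [set l | plen l = n]]) @ \oo --> (0 : R) &
      forall eta l, proper_prefix eta l -> w l < w eta].

(** [is_wedge x y l]: [l] is the longest common initial segment of [x] and [y].
    For [x <> y] it exists iff [x] and [y] have the same range. *)
Definition is_wedge (V : finType) (A : nat -> V -> V -> nat) (x y : inf_path A)
    (l : fin_path A) :=
  [/\ cylinder l x, cylinder l y &
      forall l', cylinder l' x -> cylinder l' y -> (plen l' <= plen l)%N].

Definition wedge (V : finType) (A : nat -> V -> V -> nat) (x y : inf_path A) :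
    option (fin_path A) :=
  if pselect (exists l, is_wedge x y l) is left h then Some (projT1 (cid h))
  else None.

Definition dist (R : realType) (V : finType) (A : nat -> V -> V -> nat)
    (w : fin_path A -> R) (x y : inf_path A) : R :=
  if pselect (x = y) then 0
  else if wedge x y is Some l then w l else 1.

Definition diam (R : realType) (V : finType) (A : nat -> V -> V -> nat)
    (d : inf_path A -> inf_path A -> R) (l : fin_path A) : R :=
  sup [set d x y | x in cylinder l & y in cylinder l].

Definition is_choice_function (R : realType) (V : finType)
    (A : nat -> V -> V -> nat) (d : inf_path A -> inf_path A -> R)
    (tau : fin_path A -> inf_path A * inf_path A) :=
  forall g, [/\ cylinder g (tau g).1, cylinder g (tau g).2 &
                d (tau g).1 (tau g).2 = diam d g].

(** An operator on [l^2(FB, C^2)] of the form [\bigoplus_g T_g], [T_g] a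
    2 x 2 matrix, is represented by its family of blocks; products and Borel
    functional calculus are then computed blockwise. *)
Definition block_op (R : realType) (V : finType) (A : nat -> V -> V -> nat) :=
  fin_path A -> 'M[R[i]]_2.

(** The functional calculus [g(M)] of a normal matrix [M], obtained from its
    unitary diagonalization. *)
Definition mx_calculus (R : realType) n (g : R[i] -> R[i]) (M : 'M[R[i]]_n) :
    'M[R[i]]_n :=
  invmx (spectralmx M) *m diag_mx (map_mx g (spectral_diag M)) *m spectralmx M.

Definition dirac_op (R : realType) (V : finType) (A : nat -> V -> V -> nat)
    (d : inf_path A -> inf_path A -> R) : block_op R A :=
  fun g => (real_complex R (diam d g)^-1) *: \matrix_(a, b) (a != b)%:R.

Definition abs_dirac_pow (R : realType) (V : finType)
    (A : nat -> V -> V -> nat) (d : inf_path A -> inf_path A -> R) (s : R) :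
    block_op R A :=
  fun g => mx_calculus (fun z => real_complex R (Normc.normc z `^ (- s)))
             (dirac_op d g).

Definition pi_rep (R : realType) (V : finType) (A : nat -> V -> V -> nat)
    (tau : fin_path A -> inf_path A * inf_path A) (f : inf_path A -> R[i]) :
    block_op R A :=
  fun g => diag_mx (\row_a (if a == 0 then f (tau g).1 else f (tau g).2)).

(** Traces are sums of the diagonal coefficients over the canonical orthonormal
    basis, indexed by [FB * {0, 1}]: [pos_trace] is the [[0, +oo]]-valued trace
    of a positive operator, [trace] the trace of a trace class operator (the
    limit over finite subsets of the basis, with a junk value if it diverges). *)
Definition pos_trace (R : realType) (V : finType) (A : nat -> V -> V -> nat)
    (T : block_op R A) : \bar R :=
  \esum_(p in [set: fin_path A * 'I_2]) (complex.Re (T p.1 p.2 p.2))%:E.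

Definition trace (R : realType) (V : finType) (A : nat -> V -> V -> nat)
    (T : block_op R A) : (R[i])^o :=
  summability.sum (fun p : fin_path A * 'I_2 => T p.1 p.2 p.2 : (R[i])^o).

Definition zeta (R : realType) (V : finType) (A : nat -> V -> V -> nat)
    (d : inf_path A -> inf_path A -> R) (s : R) : \bar R :=
  ((2^-1)%:E * pos_trace (abs_dirac_pow d s))%E.

(** With [ereal_inf], a zeta function that diverges everywhere has abscissa of
    convergence [+oo], hence no real one. *)
Definition is_abscissa (R : realType) (V : finType) (A : nat -> V -> V -> nat)
    (d : inf_path A -> inf_path A -> R) (s0 : R) :=
  ereal_inf [set s%:E | s in [set s : R | 0 < s /\ (zeta d s < +oo)%E]] = s0%:E.

Definition zeta_regular (R : realType) (V : finType) (A : nat -> V -> V -> nat)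
    (d : inf_path A -> inf_path A -> R) :=
  exists s0 : R, [/\ 0 < s0, is_abscissa d s0 &
    forall tau, is_choice_function d tau ->
    forall f : inf_path A -> (R[i])^o, continuous f ->
    cvg ((fun s : R =>
            trace (fun g => abs_dirac_pow d s g *m pi_rep tau f g) /
            trace (abs_dirac_pow d s) : (R[i])^o) @ s0^'+)].

(** The stationary diagram of [L]: level [n] uses the matrix of index
    [n %% k], i.e. [E_(n+1)] uses [A_i] with [n + 1 = i] modulo [k]. *)
Definition kbratteli k V (L : kgraph k V) (n : nat) : V -> V -> nat :=
  adj L (n %% k).

(** With [plen eta = q * k + t], [t < k], the factor [rho i] ([i < k]) occurs
    [q + 1] times if [i < t] and [q] times otherwise. *)
Definition w_delta (R : realType) k (V : finType) (L : kgraph k V) (x : V -> R)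
    (delta : R) (eta : fin_path (kbratteli L)) : R :=
  (\prod_(i < k) rho R L i ^+ (plen eta %/ k + (i < plen eta %% k)))
    `^ (- delta^-1) * x (psrc eta).

Definition d_delta (R : realType) k (V : finType) (L : kgraph k V) (x : V -> R)
    (delta : R) : inf_path (kbratteli L) -> inf_path (kbratteli L) -> R :=
  dist (w_delta x delta).

(* Main.v *)
Require Import Defs.
From mathcomp Require Import all_boot all_order all_algebra.
From mathcomp Require Import finmap spectral complex.
From mathcomp Require Import all_classical all_reals all_analysis.
From mathcomp Require Import ring lra.
From mathcomp Require summability.

(** The terms of [Tr |D|^-s] are the numbers [w_delta l `^ s], so the part of
    the trace carried by the paths extending a given one is governed by the
    values [Psi_i(v)] of a Dirichlet series at level [i] mod [k] and vertex [v],
    which satisfy a finite linear system.  After rescaling, the system reads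
    [Y = H + z P Y], where [P] is a nonnegative matrix fixing a positive vector
    (the Perron-Frobenius vector) and [z = rho^((1 - s/delta)/k)].  Hence [Y] is
    finite iff [z < 1] iff [delta < s], and [(1 - z) Y] converges to a positive
    vector as [s] decreases to [delta]: this is Abel summation in the mean
    ergodic theorem, and it requires no irreducibility of [P].  For continuous
    [f] the ratio of traces is then Cauchy: up to [e], [f] is constant on the
    cylinders of a finite partition, which is found by bar induction along the
    tree of finite paths. *)

Set Implicit Arguments.
Unset Strict Implicit.
Unset Printing Implicit Defensive.

Import Order.TTheory GRing.Theory Num.Theory.
Import numFieldNormedType.Exports.

Local Open Scope classical_set_scope.
Local Open Scope ring_scope.

(* The obstacle is that P need not be irreducible: the diagram uses the matrices A_i in cyclic
   order, and P may split into several blocks even when the k-graph is strongly connected. So the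
   limit of (1 - z) Y need not be a multiple of the Perron-Frobenius vector, and only its existence
   and positivity are proved. No measure on the path space is constructed either. A choice function
   attaches its points to finite paths, so [f] enters the trace as a function [phi] of finite paths
   whose values settle along each infinite path. On a cylinder where [phi] varies by at most [e],
   the trace is a constant times the mass of the cylinder, up to [e] times that mass. Such
   proportional errors add up over a partition without growing, whatever the number of pieces. The
   finitely many paths too short to lie in a piece are removed by the factor 1 - z. Real and
   imaginary parts are shifted by a bound [M], so that all sums have nonnegative terms and can be
   taken in the extended reals. *)
#[local] Existing Instance summability.totally_filter.

(** * Abel means of a nonnegative matrix with a positive fixed vector *)

Section harmonic.
Variables (R : realType) (J : finType) (P : J -> J -> R) (x : J -> R).
Hypotheses (P_ge0 : forall i j, 0 <= P i j) (x_gt0 : forall i, 0 < x i).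
Hypothesis Px : forall i, \sum_j P i j * x j = x i.

(** At an index maximising [Y i / x i], the identity [Px] bounds the sum by this maximum q times
    [x i]; hence q <= (1 - z) C + z q, and 1 - z is positive. *)
Lemma discounted_max_principle (z C : R) (Y : J -> R) : 0 <= z < 1 ->
  (forall i, Y i <= (1 - z) * C * x i + z * \sum_j P i j * Y j) ->
  forall i, Y i <= C * x i.
Proof.
move=> /andP[z0 z1] YP i0.
pose q i := Y i / x i.
case: (@Order.TotalTheory.arg_maxP _ _ _ i0 xpredT q) => // i _ imax.
have Yq j : Y j = q j * x j by rewrite /q mulfVK // gt_eqF.
have : \sum_j P i j * Y j <= q i * x i.
  rewrite -[in leRHS]Px mulr_sumr; apply: ler_sum => j _.
  rewrite mulrCA; apply: ler_wpM2l => //.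
  by rewrite Yq ler_pM2r //; exact: (imax j isT).
move=> /(ler_wpM2l z0) /(lerD (lexx ((1 - z) * C * x i))) /(le_trans (YP i)).
rewrite (Yq i) mulrA -mulrDl ler_pM2r // => qle.
have qC : q i <= C.
  rewrite -(@ler_pM2l _ (1 - z)) ?subr_gt0 //; lra.
rewrite Yq ler_pM2r //; apply: le_trans qC; exact: (imax i0 isT).
Qed.

(* [u - n y] is the image of [u] under the [n]-th power of [P], hence bounded. *)
Lemma bounded_iterates (u y : J -> R) : (forall i, y i = u i - \sum_j P i j * u j) ->
  (forall i, \sum_j P i j * y j = y i) -> forall i, y i = 0.
Proof.
move=> yu Py i0.
pose C := \sum_i `|u i| / x i.
have uC i : `|u i| <= C * x i.
  rewrite -ler_pdivrMr // /C (bigD1 i) //= lerDl sumr_ge0 // => j _.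
  by rewrite divr_ge0 // ltW.
have uny n i : `|u i - n%:R * y i| <= C * x i.
  elim: n i => [|n IH] i; first by rewrite mul0r subr0.
  have -> : u i - n.+1%:R * y i = \sum_j P i j * (u j - n%:R * y j).
    under [RHS]eq_bigr do rewrite mulrBr mulrCA.
    rewrite sumrB -mulr_sumr Py -[in RHS](subKr (u i) (\sum_j _)) -yu -natr1.
    by ring.
  apply: le_trans (ler_norm_sum _ _ _) _.
  rewrite -Px mulr_sumr; apply: ler_sum => j _.
  by rewrite normrM ger0_norm // mulrCA ler_wpM2l.
have ny n : n%:R * `|y i0| <= C * x i0 + `|u i0|.
  rewrite -[n%:R]ger0_norm // -normrM.
  by have := uny n i0; have := ler_distD (u i0) 0 (n%:R * y i0);
    rewrite !sub0r !normrN; lra.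
apply/eqP; rewrite -normr_eq0 eq_le normr_ge0 andbT leNgt; apply/negP => y0.
have := ny (Num.trunc ((C * x i0 + `|u i0|) / `|y i0|)).+1.
rewrite -ler_pdivlMr // leNgt truncnS_gt //.
Qed.

(* [P] being power bounded, the kernel and the range of [I - P] meet in 0, hence
   span the whole space. *)
Lemma mean_ergodic_splitting (h : J -> R) : exists h0 u : J -> R,
  (forall i, \sum_j P i j * h0 j = h0 i) /\
  (forall i, h i = h0 i + (u i - \sum_j P i j * u j)).
Proof.
(* The transpose of I - P, so that the row vector [v *m M] holds (I - P) v. *)
pose M : 'M[R]_#|J| :=
  \matrix_(j, i) ((i == j)%:R - P (enum_val i) (enum_val j)).
have ME (v : 'rV[R]_#|J|) i : (v *m M) 0 (enum_rank i) =
    v 0 (enum_rank i) - \sum_j P i j * v 0 (enum_rank j).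
  rewrite mxE; under eq_bigr do rewrite mxE mulrBr enum_rankK.
  rewrite sumrB (bigD1 (enum_rank i)) //= eqxx mulr1 big1 ?addr0; last first.
    by move=> j ji; rewrite eq_sym (negPf ji) mulr0.
  congr (_ - _); rewrite (reindex enum_rank) /=; last first.
    by exists enum_val => ? _; rewrite ?enum_rankK ?enum_valK.
  by apply: eq_bigr => j _; rewrite enum_rankK mulrC.
have /mxdirect_addsP : (kermx M :&: M)%MS = 0.
  apply/eqP; rewrite -submx0; apply/rV_subP => v; rewrite sub_capmx submx0.
  move=> /andP[/sub_kermxP vM /submxP[u vu]]; apply/eqP/rowP => i.
  rewrite mxE -(enum_valK i).
  apply: (@bounded_iterates (fun j => u 0 (enum_rank j)) (fun j =>
    v 0 (enum_rank j))) => j.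
    by rewrite vu ME.
  by have := ME v j; rewrite vM mxE => /esym/eqP; rewrite subr_eq0 => /eqP.
move=> /mxdirectP /= rk.
have full : row_full (kermx M + M)%MS.
  by rewrite /row_full rk mxrank_ker subnK // rank_leq_row.
have /sub_addsmxP[[a b] /= hE] := @submx_full _ _ _ _ (\row_i h (enum_val i)) _ full.
exists (fun j => (a *m kermx M) 0 (enum_rank j)), (fun j => b 0 (enum_rank j)).
split=> i.
  have := ME (a *m kermx M) i.
  by rewrite -mulmxA mulmx_ker mulmx0 mxE => /esym/eqP; rewrite subr_eq0 => /eqP.
by rewrite -ME; have := congr1 (fun A : 'rV_ _ => A 0 (enum_rank i)) hE;
  rewrite !mxE enum_rankK.
Qed.

Variables (T : Type) (F : set_system T).
Context {FF : ProperFilter F}.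
Variables (z : T -> R) (Y H : T -> J -> R).
Hypothesis z01 : \forall t \near F, 0 <= z t < 1.
Hypothesis z1 : z t @[t --> F] --> (1 : R).
Hypothesis YE : \forall t \near F,
  forall i, Y t i = H t i + z t * \sum_j P i j * Y t j.

(** The limit is the [P]-invariant part [h0] of [h]. The error [E] of (1 - z) Y against h0 + (1 - z)
    u solves a discounted system again, with source (1 - z) r where [r] tends to 0; the maximum
    principle for [E] and its negative then makes it small. *)
Lemma abel_limit (h : J -> R) : (forall i, H t i @[t --> F] --> h i) ->
  exists l : J -> R, forall i, (1 - z t) * Y t i @[t --> F] --> l i.
Proof.
move=> Hh; have [h0 [u [Ph0 hE]]] := mean_ergodic_splitting h.
exists h0 => i0.
pose Pu i := \sum_j P i j * u j.
pose r t i := (H t i - h i) - (1 - z t) * Pu i.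
pose E t i := (1 - z t) * Y t i - (h0 i + (1 - z t) * u i).
have r0 i : r t i @[t --> F] --> (0 : R).
  rewrite -[0 : R](_ : (h i - h i) - (1 - 1) * Pu i = _);
    last by rewrite !subrr mul0r subrr.
  apply: cvgB; first by apply: cvgB; [exact: Hh|exact: cvg_cst].
  by apply: cvgM; [apply: cvgB => //; exact: cvg_cst|exact: cvg_cst].
have E0 : E t i0 @[t --> F] --> (0 : R).
  apply/cvgrPdist_le => e e0.
  have rx : \forall t \near F, forall i, `|r t i| <= e / x i0 * x i.
    apply: filter_forall => i.
    have := r0 i => /cvgrPdist_le /(_ (e / x i0 * x i)).
    rewrite !mulr_gt0 ?invr_gt0 // => /(_ isT).
    by apply: filterS => t; rewrite sub0r normrN.
  near=> t.
  have zt : 0 <= z t < 1 by near: t.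
  have Yt : forall i, Y t i = H t i + z t * \sum_j P i j * Y t j by near: t.
  have rt : forall i, `|r t i| <= e / x i0 * x i by near: t.
  have EP i : E t i = (1 - z t) * r t i + z t * \sum_j P i j * E t j.
    have -> : \sum_j P i j * E t j = (1 - z t) * \sum_j P i j * Y t j - (h0 i + (1
      - z t) * Pu i).
      rewrite -Ph0 /Pu !mulr_sumr -big_split /= -sumrB.
      by apply: eq_bigr => j _; rewrite /E; ring.
    by rewrite /E /r Yt hE -/(Pu i); ring.
  have [zt0 zt1] := andP zt.
  rewrite sub0r normrN -[e](mulfVK (lt0r_neq0 (x_gt0 i0))) ler_norml; apply/andP; split.
    rewrite lerNl; apply: (@discounted_max_principle (z t) (e / x i0) (fun i =>
      - E t i)) => // i.
    rewrite /= [in leLHS]EP opprD; under eq_bigr do rewrite mulrN;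
      rewrite sumrN mulrN lerD2r -mulrN -mulrA.
    apply: ler_wpM2l; first by rewrite subr_ge0 ltW.
    by have := rt i; rewrite ler_norml => /andP[]; rewrite lerNl.
  apply: (@discounted_max_principle (z t) (e / x i0) (E t)) => // i.
  rewrite {1}EP lerD2r -mulrA.
  apply: ler_wpM2l; first by rewrite subr_ge0 ltW.
  by have := rt i; rewrite ler_norml => /andP[].
have -> : (fun t => (1 - z t) * Y t i0) = (fun t => E t i0 + (h0 i0 + (1 - z t) * u i0)).
  by apply/funext => t; rewrite /E subrK.
suff: E t i0 + (h0 i0 + (1 - z t) * u i0) @[t --> F] -->
    0 + (h0 i0 + (1 - 1) * u i0) by rewrite subrr mul0r addr0 add0r.
apply: cvgD => //.
apply: cvgD; first exact: cvg_cst.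
by apply: cvgM; [apply: cvgB => //; exact: cvg_cst|exact: cvg_cst].
Unshelve. all: by end_near.
Qed.

(** The maximum principle for the negated means. It is what keeps the limit given by [abel_limit]
    strictly positive. *)
Lemma abel_mean_ge (m : R) : (\forall t \near F, forall i, m * x i <= H t i) ->
  \forall t \near F, forall i, m * x i <= (1 - z t) * Y t i.
Proof.
move=> mH; near=> t => i.
have zt : 0 <= z t < 1 by near: t.
have Yt : forall i, Y t i = H t i + z t * \sum_j P i j * Y t j by near: t.
have mt : forall i, m * x i <= H t i by near: t.
have [zt0 zt1] := andP zt.
rewrite -lerN2 -[leRHS]mulNr.
apply: (@discounted_max_principle (z t) (- m) (fun i => - ((1 - z t) * Y t i))) => // {}i.
rewrite /=; under eq_bigr do rewrite mulrN mulrCA; rewrite sumrN -mulr_sumr [in leLHS]Yt.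
have := @ler_wpM2l _ (1 - z t) _ _ _ (mt i); rewrite subr_ge0 ltW // => /(_ isT).
by set S := \sum_j _; lra.
Unshelve. all: by end_near.
Qed.
End harmonic.

(** * Convergence up to a proportional error *)

Section almost_converges.
Variables (R : realType) (T : Type) (F : set_system T).
Context {FF : ProperFilter F}.
Variable lam : T -> R.
Hypothesis lam_ge0 : \forall t \near F, 0 <= lam t.

(** Here [u1] is the mass over which [u] is summed. Charging the error to this mass, instead of
    allowing a plain [e], makes the notion additive with the same [e]. *)
Definition almost_cvg (e : R) (u u1 : T -> R) := exists l : R, forall eta, 0 < eta ->
  \forall t \near F, `|lam t * u t - l| <= e * (lam t * u1 t) + eta.

Lemma almost_cvg_ext e u u1 w w1 : (\forall t \near F, u t = w t /\ u1 t = w1 t) ->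
  almost_cvg e u u1 -> almost_cvg e w w1.
Proof.
move=> uw [l Hl]; exists l => eta /Hl.
by apply: filterS2 uw => t [-> ->].
Qed.

Lemma almost_cvgD e u u1 w w1 : almost_cvg e u u1 -> almost_cvg e w w1 ->
  almost_cvg e (fun t => u t + w t) (fun t => u1 t + w1 t).
Proof.
move=> [l Hl] [m Hm]; exists (l + m) => eta eta0.
have e2 : 0 < eta / 2 by rewrite divr_gt0.
apply: filterS2 (Hl _ e2) (Hm _ e2) => t ul um.
have -> : lam t * (u t + w t) - (l + m) = (lam t * u t - l) + (lam t * w t - m) by ring.
apply: le_trans (ler_normD _ _) _; lra.
Qed.

Lemma almost_cvg_sum (I : eqType) (r : seq I) e (u u1 : I -> T -> R) :
  (forall i, i \in r -> almost_cvg e (u i) (u1 i)) ->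
  almost_cvg e (fun t => \sum_(i <- r) u i t) (fun t => \sum_(i <- r) u1 i t).
Proof.
elim: r => [_|i r IH H].
  exists 0 => eta eta0; apply: nearW => t.
  by rewrite !big_nil !mulr0 subrr normr0 add0r ltW.
apply: almost_cvg_ext (almost_cvgD (H i _) (IH _)); last 2 first.
- by rewrite inE eqxx.
- by move=> j jr; apply: H; rewrite inE jr orbT.
by apply: nearW => t; rewrite !big_cons.
Qed.

Lemma almost_cvg0 e u u1 : 0 <= e -> lam t * u t @[t --> F] --> (0 : R) ->
  (\forall t \near F, 0 <= u1 t) -> almost_cvg e u u1.
Proof.
move=> e0 /cvgrPdist_le u0 u1_ge0; exists 0 => eta /u0 H.
near=> t; rewrite subr0.
apply: (@le_trans _ _ eta).
  by rewrite -normrN -sub0r; near: t.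
rewrite lerDr mulr_ge0 // mulr_ge0 //; by near: t.
Unshelve. all: by end_near. Qed.

(** The case of a cylinder on which the summed function is within [e] of the constant [c]. *)
Lemma almost_cvg_dominated e c k u u1 : lam t * u1 t @[t --> F] --> (k : R) ->
  (\forall t \near F, `|u t - c * u1 t| <= e * u1 t) -> almost_cvg e u u1.
Proof.
move=> Hk H; exists (c * k) => eta eta0.
have Hck : lam t * (c * u1 t) @[t --> F] --> c * k.
  by under eq_fun do rewrite mulrCA; apply: cvgM => //; exact: cvg_cst.
move/cvgrPdist_le : Hck => /(_ _ eta0) Hck.
near=> t; rewrite (_ :
  _ - _ = lam t * (u t - c * u1 t) - (c * k - lam t * (c * u1 t))); last by ring.
apply: le_trans (ler_normB _ _) _; apply: lerD; last by near: t.
rewrite normrM ger0_norm; last by near: t.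
rewrite mulrCA; apply: ler_wpM2l; by near: t.
Unshelve. all: by end_near. Qed.

(** The factor [lam] cancels in the ratio. The value [l] depends on [e], so there is no candidate
    for the limit and completeness has to provide it. *)
Lemma almost_cvg_ratio k u u1 : 0 < k -> lam t * u1 t @[t --> F] --> (k : R) ->
  (\forall t \near F, 0 < lam t) ->
  (forall e, 0 < e -> almost_cvg e u u1) -> cvg (u t / u1 t @[t --> F]).
Proof.
move=> k0 Hk lam_gt0 H; apply: cauchy_cvg; apply: cauchy_exP => e e0.
have e4 : 0 < e / 4 by rewrite divr_gt0.
have [l Hl] := H _ e4; exists (l / k).
have Hlk : l / (lam t * u1 t) @[t --> F] --> l / k.
  by apply: cvgM; [exact: cvg_cst|apply: cvgV => //; rewrite gt_eqF].
move/cvgrPdist_le : Hlk => /(_ _ e4) Hlk.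
have k2 : k / 2 < k by lra.
(* Once the mass exceeds [k / 2], dividing this [eta] by it leaves at most [e / 4]. *)
have eta0 : 0 < e / 4 * (k / 2) by rewrite !mulr_gt0 ?divr_gt0.
have Hk2 : \forall t \near F, k / 2 < lam t * u1 t by exact: cvgr_gt k2.
change (\forall t \near F, ball (l / k) e (u t / u1 t)); near=> t.
have Lt : 0 < lam t by near: t.
have kt : k / 2 < lam t * u1 t by near: t.
have Pt : 0 < lam t * u1 t by apply: lt_trans kt; rewrite divr_gt0.
rewrite /ball /= (_ : l / k - u t / u1 t =
    (l / k - l / (lam t * u1 t)) - (lam t * u t - l) / (lam t * u1 t)); last first.
  by field; rewrite !gt_eqF //; move: Pt; rewrite pmulr_rgt0.
apply: le_lt_trans (ler_normB _ _) _.
apply: (@le_lt_trans _ _ (e / 4 + (e / 4 + e / 4))); last by lra.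
apply: lerD; first by near: t.
rewrite normrM normfV (gtr0_norm Pt) ler_pdivrMr //.
apply: (@le_trans _ _ (e / 4 * (lam t * u1 t) + e / 4 * (k / 2)));
  first by near: t; exact: Hl.
rewrite mulrDl lerD2l; apply: ler_wpM2l; exact: ltW.
Unshelve. all: by end_near. Qed.
End almost_converges.

Lemma pos_lower_bound (R : realFieldType) (I : finType) (h : I -> R) :
  (forall i, 0 < h i) -> exists2 m, 0 < m & forall i, m <= h i.
Proof.
move=> h0; have S0 : 0 <= \sum_i (h i)^-1.
  by apply: sumr_ge0 => i _; rewrite invr_ge0 ltW.
have C0 : 0 < 1 + \sum_i (h i)^-1 by rewrite ltr_wpDr.
(* Unlike a minimum, this witness also serves for an empty [I]. *)
exists (1 + \sum_i (h i)^-1)^-1 => [|i]; first by rewrite invr_gt0.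
rewrite -[leRHS]invrK lef_pV2 ?posrE ?invr_gt0 //.
rewrite (bigD1 i) //= addrCA lerDl addr_ge0 // sumr_ge0 // => j _.
by rewrite invr_ge0 ltW.
Qed.

Lemma esumZl (R : realType) (T : choiceType) (D : set T) (c : R) (F : T -> \bar R) :
  0 <= c -> (forall i, 0 <= F i)%E ->
  (\esum_(i in D) (c%:E * F i) = c%:E * \esum_(i in D) F i)%E.
Proof.
rewrite le_eqVlt => /predU1P[<- _|c0 F0].
  by rewrite mul0e esum1 // => i _; rewrite mul0e.
rewrite /esum -ereal_sup_pZl // image_comp.
by congr ereal_sup; apply: eq_imagel => X _ /=; rewrite ge0_mule_fsumr.
Qed.

Lemma EFin_natr_mule (R : realType) (y : \bar R) n : (n%:R%:E * y)%E = y *+ n.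
Proof.
elim: n => [|n IH]; first by rewrite mul0e mulr0n.
by rewrite !mulrS EFinD ge0_muleDl ?lee_fin // mul1e IH.
Qed.

Lemma cvg_powR_exponent (R : realType) (T : Type) (F : set_system T) (FF : Filter F)
    (f : T -> R) (b l : R) : 0 < b ->
  f t @[t --> F] --> l -> b `^ f t @[t --> F] --> b `^ l.
Proof.
move=> b0 fl; rewrite /powR gt_eqF //.
apply: (@cvg_comp _ _ _ _ expR _ (nbhs (l * ln b))); last exact: continuous_expR.
by apply: cvgM => //; exact: cvg_cst.
Qed.

(** * Finite and infinite paths *)

Section paths.
Variables (V : finType) (A : nat -> V -> V -> nat).

Definition pend (v : V) (q : seq (edge V)) : V := last v (map (@esrc V) q).

Definition paths_from l v : set (seq (edge V)) := [set q | is_path A l v q].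

Definition out_edges l v : seq (edge V) :=
  [seq (v, u, j) | u <- enum V, j <- iota 0 (A l v u)].

Lemma out_edges_uniq l v : uniq (out_edges l v).
Proof.
apply: allpairs_uniq_dep; [exact: enum_uniq|by move=> *; exact: iota_uniq|].
by move=> [u j] [u' j'] _ _ [-> ->].
Qed.

Lemma mem_out_edges l v e :
  (e \in out_edges l v) = (erng e == v) && is_edge A l e.
Proof.
apply/allpairsPdep/andP => [[u [j [_ jA ->]]]|[/eqP<- eA]].
  by rewrite mem_iota add0n in jA; rewrite eqxx.
case: e eA => -[v' u] j eA; exists u, j; split => //; first by rewrite mem_enum.
by rewrite mem_iota add0n.
Qed.

Lemma big_out_edges (S : nmodType) (G : V -> S) l v :
  \sum_(e <- out_edges l v) G (esrc e) = \sum_u G u *+ A l v u.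
Proof.
rewrite big_allpairs_dep /= big_enum; apply: eq_bigr => u _.
rewrite (_ : iota 0 (A l v u) = index_iota 0 (A l v u)).
  by rewrite /esrc /= sumr_const_nat subn0.
by rewrite /index_iota subn0.
Qed.

Lemma pend_cat v q r : pend v (q ++ r) = pend (pend v q) r.
Proof. by rewrite /pend map_cat last_cat. Qed.

Lemma pend_rcons v q e : pend v (rcons q e) = esrc e.
Proof. by rewrite /pend map_rcons last_rcons. Qed.

Lemma is_path_cat l v q r : is_path A l v (q ++ r) =
  is_path A l v q && is_path A (l + size q) (pend v q) r.
Proof.
elim: q l v => [|e q IH] l v /=; first by rewrite addn0.
by rewrite IH addSnnS -!andbA.
Qed.

Lemma is_path_rcons l v q e : is_path A l v (rcons q e) =
  [&& is_path A l v q, erng e == pend v q & is_edge A (l + size q) e].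
Proof. by rewrite -cats1 is_path_cat /= andbT. Qed.

Variable R : realType.

Lemma esum_paths_step l v (F : seq (edge V) -> \bar R) :
  (forall q, 0 <= F q)%E ->
  \esum_(q in paths_from l v) F q =
  (F [::] + \sum_(e <- out_edges l v)
     \esum_(q in paths_from l.+1 (esrc e)) F (e :: q))%E.
Proof.
move=> F0; rewrite (esumID [set [::]]) //; congr (_ + _)%E.
  rewrite (_ : _ `&` _ = [set [::]]) ?esum_set1 //.
  by apply/seteqP; split => [q [_ ->]|q ->].
rewrite fsbig_seq ?out_edges_uniq // -esum_fset //; last first.
  by move=> e _; exact: esum_ge0.
rewrite esum_esum //.
apply: (@reindex_esum R _ _ _ _ (fun p : edge V * seq (edge V) => p.1 :: p.2)).
split => [[e q] /= [+ qP]|[e q] [e' q'] _ _ [-> ->] //|[|e q] /= [+ //]].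
  rewrite mem_out_edges => /andP[ev eA]; split=> //.
  by rewrite /paths_from /= ev eA.
rewrite /paths_from /= => /and3P[ev eA qP] _; exists (e, q) => //=; split => //=.
by rewrite mem_out_edges ev.
Qed.

Lemma is_path_mod k (Aper : forall l, A l = A (l %% k)) l l' v q :
  l = l' %[mod k] -> is_path A l v q = is_path A l' v q.
Proof.
elim: q l l' v => //= e q IH l l' v ll'.
rewrite (IH l.+1 l'.+1); last by rewrite -(addn1 l) -(addn1 l') -modnDml ll' modnDml.
by rewrite /is_edge (Aper l) ll' -(Aper l').
Qed.

End paths.

(** * Bar induction on the tree of finite paths *)

Section bar.
Variables (V : finType) (A : nat -> V -> V -> nat).

(** If [Q] fails at a path, it fails at some one-edge extension; iterating a choice of such edges
    builds an infinite path with no prefix in [Q]. This replaces compactness of the path space. At a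
    path without outgoing edges the premise of the step is vacuous, so [Q] holds there. *)
Lemma bar_induction (Q : V -> seq (edge V) -> Prop) :
  (forall y : inf_path A, exists n, Q (erng (y 0%N)) (mkseq y n)) ->
  (forall v r, is_path A 0 v r ->
    (forall e, e \in out_edges A (size r) (pend v r) -> Q v (rcons r e)) -> Q v r) ->
  forall v, Q v [::].
Proof.
move=> Qbar Qstep v; apply: contrapT => nQ.
pose bad r := is_path A 0 v r /\ ~ Q v r.
have ext r : exists e, bad r ->
    e \in out_edges A (size r) (pend v r) /\ bad (rcons r e).
  apply: contrapT => /forallNP H.
  have [[rP nQr]|nbad] := pselect (bad r); last first.
    by apply: (H (v, v, 0%N)) => /nbad.
  apply: nQr; apply: Qstep => // e eE; apply: contrapT => nQe.
  apply: (H e) => _; split => //; split => //.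
  by move: eE; rewrite is_path_rcons rP mem_out_edges add0n.
have [g gP] := choice ext.
pose s n := iter n (fun r => rcons r (g r)) [::].
have sbad n : bad (s n) by elim: n => [|n IH]; [split|have [] := gP _ IH].
have ssize n : size (s n) = n by elim: n => //= n IH; rewrite size_rcons IH.
have gE n : erng (g (s n)) == pend v (s n) /\ is_edge A n (g (s n)).
  by have [+ _] := gP _ (sbad n); rewrite mem_out_edges ssize => /andP.
have yP n : is_edge A n (g (s n)) /\ esrc (g (s n)) = erng (g (s n.+1)).
  have [_ ->] := gE n; split => //.
  by have [/eqP -> _] := gE n.+1; rewrite /= pend_rcons.
pose y := InfPath (A := A) (inf_path_edge := fun n => g (s n)) yP.
have ys n : mkseq y n = s n by elim: n => // n IH; rewrite mkseqS IH.
have yv : erng (y 0%N) = v by have [/eqP] := gE 0%N.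
by have [n] := Qbar y; rewrite ys yv; have [] := sbad n.
Qed.

(** A basic neighbourhood is a finite intersection of cylinders, and the longest of them gives [n].
    The range is compared separately because a prefix of length 0 does not record it. *)
Lemma nbhs_inf_path (y : inf_path A) (B : set (inf_path A)) : nbhs y B ->
  exists n, forall y' : inf_path A, erng (y' 0%N) = erng (y 0%N) ->
    mkseq y' n = mkseq y n -> B y'.
Proof.
rewrite nbhsE => -[W [Wo Wy] WB].
have [D sD DW] := Wo; move: Wy; rewrite -DW => -[S /= DS Sy].
have [F FD FS] := sD _ DS.
have Fy : forall C, C \in F -> C y by move=> C CF; move: Sy; rewrite -FS; apply.
have Fcyl C : C \in F -> exists l : fin_path A, cylinder l = C.
  by move=> /FD; rewrite inE => -[l _ <-]; exists l.
have H : forall C : set (inf_path A), exists n, C \in F -> forall y' : inf_path A,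
    erng (y' 0%N) = erng (y 0%N) -> mkseq y' n = mkseq y n -> C y'.
  move=> C; have [CF|] := boolP (C \in F); last by exists 0%N.
  have [l lC] := Fcyl _ CF; exists (plen l) => _ y' ey my.
  by have := Fy _ CF; rewrite -lC /cylinder /= ey my.
have [nn nnP] := choice H.
exists (\max_(C <- F) nn C)%N => y' ey my; apply: WB; rewrite -DW.
have FS' : S = \bigcap_(C in [set` F]) C by rewrite -FS.
exists S; [exact: DS|change (S y')]; rewrite FS' => C /= CF; apply: (nnP C CF) => //.
have le : (nn C <= \max_(C <- F) nn C)%N by exact: leq_bigmax_seq.
by have := congr1 (take (nn C)) my; rewrite /mkseq -!map_take !take_iota (minn_idPl le).
Qed.
End bar.

(** * Operators with complex blocks and their traces *)

Section complex_block.
Variable R : realType.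

Lemma normc_real (c : R) : 0 <= c -> Normc.normc (real_complex R c) = c.
Proof. by move=> c0; rewrite /Normc.normc /= expr0n addr0 sqrtr_sqr ger0_norm. Qed.

Lemma normc_ge0 (z : R[i]) : 0 <= Normc.normc z.
Proof. by case: z => a b; exact: sqrtr_ge0. Qed.

(** Since [M] squares to c^2, every entry of its spectral diagonal has modulus [c], whatever signs
    and order the diagonalization yields. So [g] turns the diagonal into the constant [y], and the
    conjugation drops out. *)
Lemma mx_calculus_swap (g : R[i] -> R[i]) (c : R) (y : R[i]) : 0 < c ->
  (forall z, Normc.normc z = c -> g z = y) ->
  mx_calculus g (real_complex R c *: \matrix_(a < 2, b < 2) (a != b)%:R) = y%:M.
Proof.
move=> c0 gy; set M := _ *: _.
have MM : M *m M = (real_complex R c ^+ 2)%:M.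
  apply/matrixP => i j; rewrite !mxE !big_ord_recl big_ord0 !mxE.
  by case: i j => [[|[|//]] ?] [[|[|//]] ?];
    rewrite -!val_eqE /= ?mulr0 ?mulr1 ?mul0r ?addr0 ?add0r.
have Mt : map_mx Num.conj M^T = M.
  apply/matrixP => i j; rewrite !mxE rmorphM rmorph_nat eq_sym; congr (_ * _).
  by apply: geC0_conj; rewrite ler0c ltW.
have /orthomx_spectralP ME : M \is normalmx by apply/normalmxP; rewrite Mt.
rewrite /mx_calculus; set P := spectralmx M in ME *; set D := spectral_diag M in ME *.
have Pu : P \in unitmx := spectral_unit M.
have DD : diag_mx D *m diag_mx D = (real_complex R c ^+ 2)%:M.
  have DE : diag_mx D = P *m M *m invmx P.
    by rewrite [in RHS]ME !mulmxA mulmxV // mul1mx mulmxK.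
  rewrite DE !mulmxA mulmxKV // -(mulmxA P M M) MM mul_mx_scalar -scalemxAl mulmxV //.
  by rewrite scalemx1.
have Dn i : Normc.normc (D 0 i) = c.
  have := congr1 (fun N : 'M[R[i]]_2 => Normc.normc (N i i)) DD.
  rewrite mul_diag_mx !mxE eqxx !mulr1n -/(D 0 i) !Normc.normcM normc_real ?ltW //.
  by move/eqP; rewrite -!expr2 eqrXn2 ?normc_ge0 ?ltW // => /eqP.
have -> : map_mx g D = const_mx y by apply/rowP => i; rewrite !mxE gy.
by rewrite diag_const_mx -mulmxA mul_scalar_mx -scalemxAr mulVmx // scalemx1.
Qed.

Lemma abs_dirac_powE (V : finType) (A : nat -> V -> V -> nat)
    (d : inf_path A -> inf_path A -> R) s l : 0 < diam d l ->
  abs_dirac_pow d s l = (real_complex R (diam d l `^ s))%:M.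
Proof.
move=> d0; apply: mx_calculus_swap; first by rewrite invr_gt0.
move=> z ->; congr (real_complex R _).
by rewrite -powR_inv1 ?ltW // -powRrM mulN1r opprK.
Qed.

Lemma Re_sum (I : Type) (r : seq I) (F : I -> R[i]) :
  complex.Re (\sum_(i <- r) F i) = \sum_(i <- r) complex.Re (F i).
Proof. by apply: (big_morph (@complex.Re R)) => // -[b c] [b' c']. Qed.

Lemma Im_sum (I : Type) (r : seq I) (F : I -> R[i]) :
  complex.Im (\sum_(i <- r) F i) = \sum_(i <- r) complex.Im (F i).
Proof. by apply: (big_morph (@complex.Im R)) => // -[b c] [b' c']. Qed.

Lemma cvg_complex (T : Type) (F : set_system T) (FF : Filter F) (f :
  T -> (R[i])^o) (a b : R) :
  complex.Re (f t) @[t --> F] --> a -> complex.Im (f t) @[t --> F] --> b ->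
  f t @[t --> F] --> ((a +i* b)%C : (R[i])^o).
Proof.
move=> /cvgrPdist_lt fa /cvgrPdist_lt fb; apply/cvgrPdist_lt => e e0.
have [eI eR] : complex.Im e = 0 /\ 0 < complex.Re e.
  by move: e0; rewrite ltcE /= => /andP[/eqP].
have e2 : 0 < complex.Re e / 2 by rewrite divr_gt0.
near=> t.
have ta : `|a - complex.Re (f t)| < complex.Re e / 2 by near: t; exact: fa.
have tb : `|b - complex.Im (f t)| < complex.Re e / 2 by near: t; exact: fb.
rewrite normc_def ltcE /= eI eqxx /=.
case: (f t) ta tb => u v /= ta tb.
apply: le_lt_trans (_ : `|a - u| + `|b - v| < _);
  last by rewrite (splitr (complex.Re e)) ltrD.
rewrite -[leRHS]ger0_norm ?addr_ge0 // -sqrtr_sqr ler_wsqrtr //.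
rewrite [leRHS]sqrrD !real_normK ?num_real //.
have : 0 <= `|a - u| * `|b - v| by rewrite mulr_ge0.
lra.
Unshelve. all: by end_near. Qed.

Lemma partial_sumE (I : choiceType) (U : zmodType) (r : I -> U) (B : {fset I}) :
  summability.partial_sum r B = \sum_(i <- B) r i.
Proof. by rewrite /summability.partial_sum big_seq_fsetE. Qed.

(** A finite set whose sum is within [e] of the supremum keeps this property when enlarged, the
    terms being nonnegative. *)
Lemma esum_totally_cvg (I : choiceType) (r : I -> R) : (forall i, 0 <= r i) ->
  (\esum_(i in [set: I]) (r i)%:E < +oo)%E ->
  summability.partial_sum r J @[J --> summability.totally] -->
    fine (\esum_(i in [set: I]) (r i)%:E).
Proof.
move=> r0 rfin; set S := esum _ _ in rfin *.
have Sfin : S \is a fin_num by rewrite ge0_fin_numE // esum_ge0 // => i _;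
  rewrite lee_fin.
have sumS (B : {fset I}) : \sum_(i <- B) r i <= fine S.
  rewrite -lee_fin fineK // -sumEFin; apply: esum_ge.
  exists [set` B]; first by split.
  by rewrite fsbig_seq.
apply/cvgrPdist_le => e e0.
have [_ /= [X [finX _] <-] HX] := ub_ereal_sup_adherent e0 Sfin.
exists (fset_set X) => // B /= XB.
rewrite partial_sumE ger0_norm ?subr_ge0 // lerBlDr addrC -lerBlDr.
apply: (@le_trans _ _ (\sum_(i <- fset_set X) r i)).
  have {HX} : (S - e%:E < \sum_(i \in X) (r i)%:E)%E := HX.
  rewrite fsbig_finite //= sumEFin -(fineK Sfin) -EFinB lte_fin.
  exact: ltW.
rewrite [leRHS](bigID (fun i => i \in fset_set X)) /=.
apply: ler_wpDr; first exact: sumr_ge0.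
rewrite -[leRHS]big_filter le_eqVlt; apply/orP; left; apply/eqP; apply: perm_big.
apply: uniq_perm; rewrite ?filter_uniq ?fset_uniq // => i.
by rewrite mem_filter; apply/esym/andb_idr => /(fsubsetP XB).
Unshelve. all: by end_near. Qed.

(** Adding [M] makes the terms nonnegative, so that a signed sum becomes a difference of two
    suprema. *)
Lemma bounded_sum_totally_cvg (I : choiceType) (W g : I -> R) (M : R) :
  (forall i, 0 <= W i) -> (\esum_(i in [set: I]) (W i)%:E < +oo)%E ->
  (forall i, `|g i| <= M) ->
  summability.partial_sum (fun i => W i * g i) J @[J --> summability.totally] -->
    fine (\esum_(i in [set: I]) (W i * (g i + M))%:E) - M * fine (\esum_(i in [set:
      I]) (W i)%:E).
Proof.
move=> W0 Wfin gM.
have gM0 i : 0 <= g i + M <= 2 * M.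
  by have := gM i; rewrite ler_norml => /andP[]; lra.
have r0 i : 0 <= W i * (g i + M) by rewrite mulr_ge0 //; case/andP: (gM0 i).
have -> : summability.partial_sum (fun i => W i * g i) =
    (fun J => summability.partial_sum (fun i =>
      W i * (g i + M)) J - M * summability.partial_sum W J).
  apply/funext => J; rewrite !partial_sumE mulr_sumr -sumrB.
  by apply: eq_bigr => i _; ring.
apply: cvgB; last by apply: cvgM; [exact: cvg_cst|exact: esum_totally_cvg].
apply: esum_totally_cvg => //.
(* [M] is known to be nonnegative only through a point of [I]. *)
have [[i0]|nI] := pselect (inhabited I); last first.
  by rewrite esum1 // => i; exfalso; apply: nI.
have M0 : 0 <= M := le_trans (normr_ge0 _) (gM i0).
apply: (@le_lt_trans _ _ (\esum_(i in [set: I]) ((2 * M)%:E * (W i)%:E))%E).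
  apply: le_esum => i _; rewrite -EFinM lee_fin mulrC; apply: ler_wpM2r => //.
  by case/andP: (gM0 i).
rewrite esumZl ?mulr_ge0 // ltey_eq fin_numM // ge0_fin_numE // esum_ge0 // => i _.
by rewrite lee_fin.
Qed.
End complex_block.

Lemma fsbig_setT (R : Type) (idx : R) (op : Monoid.com_law idx) (T : finType) (F :
  T -> R) :
  \big[op/idx]_(i \in [set: T]) F i = \big[op/idx]_i F i.
Proof.
rewrite (_ : [set: T] = [set` enum T]).
  by rewrite -fsbig_seq ?enum_uniq // big_enum.
by apply/seteqP; split => i //= _; rewrite mem_enum.
Qed.

(** * Continuous functions on infinite paths, and sums over finite paths *)

Section path_space.
Variables (R : realType) (V : finType) (A : nat -> V -> V -> nat).

Lemma inf_path_prefix (y : inf_path A) n :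
  is_path A 0 (erng (y 0%N)) (mkseq y n) /\ pend (erng (y 0%N)) (mkseq y n) = erng (y n).
Proof.
elim: n => [|n [IHp IHe]] //; have [yn ye] := inf_pathP y n.
by rewrite mkseqS is_path_rcons pend_rcons IHp IHe eqxx size_mkseq.
Qed.

(** Continuity in terms of prefixes. The length [n] depends on [y]; passing from points to whole
    cylinders is left to bar induction. *)
Definition locally_uniform (g : inf_path A -> R) := forall e, 0 < e ->
  forall y : inf_path A, exists n, forall y' : inf_path A,
    erng (y' 0%N) = erng (y 0%N) -> mkseq y' n = mkseq y n -> `|g y' - g y| <= e.

Lemma continuous_locally_uniform (f : inf_path A -> (R[i])^o) : continuous f ->
  locally_uniform (fun y => complex.Re (f y)) /\ locally_uniform (fun y =>
    complex.Im (f y)).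
Proof.
move=> fc; have H e (y : inf_path A) : 0 < e -> exists n, forall y' : inf_path A,
    erng (y' 0%N) = erng (y 0%N) -> mkseq y' n = mkseq y n ->
    `|f y - f y'| < real_complex R e.
  move=> e0; have e0' : 0 < real_complex R e by rewrite ltcE /= eqxx.
  have /cvgrPdist_lt /(_ _ e0') := fc y.
  exact: nbhs_inf_path.
have abs_le (z : R[i]) e : `|z| < real_complex R e ->
    `|complex.Re z| <= e /\ `|complex.Im z| <= e.
  rewrite normc_def ltcR => ze; have e0 : 0 <= e.
    by apply: le_trans (ltW ze); exact: sqrtr_ge0.
  split; apply: le_trans (ltW ze); rewrite -sqrtr_sqr ler_wsqrtr //.
    by rewrite lerDl sqr_ge0.
  by rewrite lerDr sqr_ge0.
split=> e e0 y; have [n nP] := H e y e0; exists n => y' ey my;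
  have := abs_le _ _ (nP y' ey my);
  by case: (f y) (f y') => [a b] [a' b'] /= [Hr Hi]; rewrite distrC.
Qed.

(** Bar induction on boundedness over a cylinder: finitely many one-edge extensions cover it, and
    the sum of their bounds bounds [g] on it. *)
Lemma locally_uniform_bounded (g : inf_path A -> R) : locally_uniform g ->
  exists2 M, 0 <= M & forall y, `|g y| <= M.
Proof.
move=> gU; pose Q v r := exists M, forall y : inf_path A,
  erng (y 0%N) = v -> mkseq y (size r) = r -> `|g y| <= M.
have Qv v : Q v [::].
  apply: (@bar_induction V A Q) => [y|{}v r rP IH].
    have [n nP] := gU 1 ltr01 y; exists n, (`|g y| + 1) => y' ey;
      rewrite size_mkseq => my.
    have := nP y' ey my; have := ler_distD (g y) (g y') 0; rewrite !subr0; lra.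
  have /choice[M MP] : forall e, exists M : R, e \in out_edges A (size r) (pend v r) ->
      forall y : inf_path A, erng (y 0%N) = v ->
      mkseq y (size (rcons r e)) = rcons r e -> `|g y| <= M.
    move=> e.
    have [eE|_] := boolP (e \in _); last by exists 0.
    by have [M MP] := IH e eE; exists M.
  exists (\sum_(e <- out_edges A (size r) (pend v r)) `|M e|) => y yv yr.
  have [_ ye] := inf_path_prefix y (size r); rewrite yv yr in ye.
  have yE : y (size r) \in out_edges A (size r) (pend v r).
    by rewrite mem_out_edges ye eqxx; have [] := inf_pathP y (size r).
  apply: (@le_trans _ _ (M (y (size r)))).
    by apply: MP; rewrite // size_rcons mkseqS yr.
  apply: le_trans (ler_norm _) _.
  by rewrite (bigD1_seq _ yE (out_edges_uniq _ _ _)) /= lerDl sumr_ge0.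
have [M MP] := choice Qv; exists (\sum_v `|M v|); first by rewrite sumr_ge0.
move=> y; apply: le_trans (MP _ y erefl erefl) _; apply: le_trans (ler_norm _) _.
by rewrite (bigD1 (erng (y 0%N))) //= lerDl sumr_ge0.
Qed.

Lemma esum_fin_path (F : V -> seq (edge V) -> \bar R) : (forall v r, 0 <= F v r)%E ->
  (\esum_(l in [set: fin_path A]) F (val l).1 (val l).2 =
   \sum_v \esum_(r in paths_from A 0 v) F v r)%E.
Proof.
move=> F0.
transitivity (\esum_(p in [set: V] `*`` paths_from A 0) F p.1 p.2)%E.
  apply/esym/(@reindex_esum R _ _ setT _ (fun l : fin_path A => val l)); split.
  - by move=> [[v r] /= rP] _.
  - by move=> l l' _ _; exact: val_inj.
  - by move=> [v r] [_ rP]; exists (exist _ (v, r) rP).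
rewrite -(esum_esum (a := F)) // esum_fset; last 2 first.
- exact: finite_finset.
- by move=> v _; exact: esum_ge0.
by rewrite fsbig_setT.
Qed.

Definition endpoint (tau : fin_path A -> inf_path A * inf_path A) (p :
  fin_path A * 'I_2) :=
  if p.2 == 0 then (tau p.1).1 else (tau p.1).2.

(** Moves data from [fin_path A] to raw lists, with value 0 off the paths, so that recursion on
    lists carries no proof of [is_path]. The two basis vectors attached to a path are merged by
    addition. *)
Definition path_extension (H : fin_path A * 'I_2 -> R) v r : R :=
  oapp (fun l : fin_path A => H (l, 0) + H (l, 1)) 0
    (insub (v, r) : option {p : V * seq (edge V) | is_path A 0 p.1 p.2}).

Lemma path_extension_val H (l : fin_path A) :
  path_extension H (val l).1 (val l).2 = H (l, 0) + H (l, 1).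
Proof. by rewrite /path_extension -surjective_pairing valK. Qed.

Lemma path_extensionP (T : R -> Prop) H v r :
  T 0 -> (forall l : fin_path A, val l = (v, r) -> T (H (l, 0) + H (l, 1))) ->
  T (path_extension H v r).
Proof. by rewrite /path_extension; case: insubP => //= l _ lE T0; apply. Qed.

End path_space.

(** * Dirichlet series over the paths of a periodic diagram *)

Section periodic_weights.
Variables (R : realType) (V : finType) (A : nat -> V -> V -> nat) (k : nat).
Variables (a : nat -> R) (x : V -> R) (delta : R).
Hypotheses (k_gt0 : (0 < k)%N) (Aper : forall l, A l = A (l %% k)).
Hypotheses (aper : forall l, a l = a (l %% k)) (a_gt0 : forall l, 0 < a l).
Hypothesis x_gt0 : forall v, 0 < x v.
Hypothesis Ax : forall l v, \sum_u (A l v u)%:R * x u = a l * x v.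
Hypothesis delta_gt0 : 0 < delta.
Let rho0 := \prod_(i < k) a i.
Hypothesis rho_gt1 : 1 < rho0.

(** The formula of [w_delta] for a path starting at level [l], so that tails of paths are weighed in
    the same way. *)
Definition path_weight l v (q : seq (edge V)) : R :=
  (\prod_(i < size q) a (l + i)) `^ (- delta^-1) * x (pend v q).

Lemma path_weight_gt0 l v q : 0 < path_weight l v q.
Proof. by rewrite mulr_gt0 // powR_gt0 // prodr_gt0. Qed.

Lemma path_weight_cat v r q : path_weight 0 v (r ++ q) =
  (\prod_(i < size r) a i) `^ (- delta^-1) * path_weight (size r) (pend v r) q.
Proof.
rewrite /path_weight pend_cat mulrA -powRM ?prodr_ge0 // => [|i _|i _]; try exact: ltW.
congr (_ `^ _ * _); rewrite size_cat big_split_ord /=; congr (_ * _);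
  apply: eq_bigr => i _ //=.
Qed.

Lemma path_weight_cons l v e q : path_weight l v (e :: q) =
  a l `^ (- delta^-1) * path_weight l.+1 (esrc e) q.
Proof.
rewrite /path_weight mulrA -powRM ?prodr_ge0 // => [||i _]; try exact: ltW.
congr (_ `^ _ * _); rewrite big_ord_recl addn0; congr (_ * _).
by apply: eq_bigr => i _; rewrite addSnnS.
Qed.

Lemma path_weight_mod l l' v q : l = l' %[mod k] ->
  path_weight l v q = path_weight l' v q.
Proof.
move=> ll'; congr (_ `^ _ * _); apply: eq_bigr => i _.
by rewrite (aper (l + i)) -modnDml ll' modnDml -(aper (l' + i)).
Qed.

(** [chi] selects path lengths: [xpredT] gives the full series, and [n < N] the truncations on which
    finiteness is proved by induction. *)
Definition path_zeta (chi : pred nat) s l v : \bar R :=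
  \esum_(q in paths_from A l v) (if chi (size q) then path_weight l v q `^ s else 0)%:E.

Lemma path_zeta_ge0 chi s l v : (0 <= path_zeta chi s l v)%E.
Proof. by apply: esum_ge0 => q _; rewrite lee_fin; case: ifP => // _;
  exact: powR_ge0. Qed.

Lemma path_zeta_mod chi s l l' v : l = l' %[mod k] ->
  path_zeta chi s l v = path_zeta chi s l' v.
Proof.
move=> ll'; rewrite /path_zeta.
have -> : paths_from A l v = paths_from A l' v.
  by apply/funext => q; rewrite /paths_from /= (is_path_mod Aper _ _ ll').
by apply: eq_esum => q _; rewrite (path_weight_mod _ _ ll').
Qed.

Lemma path_zeta_step chi s l v : path_zeta chi s l v =
  ((if chi 0 then x v `^ s else 0)%:E +
  \sum_u ((A l v u)%:R * a l `^ (- (s / delta)))%:E * path_zeta (chi \o succn) s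
    l.+1 u)%E.
Proof.
rewrite /path_zeta esum_paths_step; last first.
  by move=> q; rewrite lee_fin; case: ifP => // _; exact: powR_ge0.
congr (_ + _)%E.
  by rewrite /path_weight /= big_ord0 powR1 mul1r.
transitivity (\sum_(e <- out_edges A l v) (fun u => (a l `^ (- (s / delta)))%:E *
    path_zeta (chi \o succn) s l.+1 u)%E (esrc e)).
  apply: eq_bigr => e _; rewrite -esumZl ?powR_ge0 //; last first.
    by move=> q; rewrite lee_fin; case: ifP => // _; exact: powR_ge0.
  apply: eq_esum => q _; rewrite -EFinM /=; case: (chi (size q).+1);
    last by rewrite mulr0.
  rewrite path_weight_cons powRM ?powR_ge0 ?(ltW (path_weight_gt0 _ _ _)) //.
  by rewrite -powRrM mulNr (mulrC _^-1).
rewrite (big_out_edges A (fun u => (a l `^ (- (s / delta)))%:E *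
    path_zeta (chi \o succn) s l.+1 u)%E).
by apply: eq_bigr => u _; rewrite -EFin_natr_mule muleA EFinM.
Qed.

Definition defect s : R := 1 - s / delta.

(** An edge of level i weighs 1 / a_i times a_i to the power [defect s]. Over one period these
    deviations multiply to rho0 to the power [defect s]; [ratio s] is the share of each level when
    they are spread evenly. *)
Definition ratio s : R := rho0 `^ (defect s / k%:R).

(* The rescaling turns the weight [a i `^ (- (s / delta))] of an edge of level [i]
   into [ratio s / a i]: the deviation from [(a i)^-1] no longer depends on [i]. *)
Definition scale s i : R := (\prod_(j < i) a j) `^ defect s * ratio s ^- i.

Lemma rho0_gt0 : 0 < rho0.
Proof. exact: lt_trans rho_gt1. Qed.

Lemma ratio_gt0 s : 0 < ratio s.
Proof. exact: powR_gt0 rho0_gt0. Qed.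

Lemma scale_gt0 s i : 0 < scale s i.
Proof. by rewrite mulr_gt0 ?invr_gt0 ?exprn_gt0 ?ratio_gt0 // powR_gt0 // prodr_gt0. Qed.

Lemma scaled_vertex_gt0 s (p : 'I_k * V) : 0 < scale s p.1 * x p.2 `^ s / x p.2.
Proof. by rewrite divr_gt0 // pmulr_rgt0 ?scale_gt0 // powR_gt0. Qed.

Lemma ratio_lt1 s : (ratio s < 1) = (delta < s).
Proof.
rewrite /ratio /powR gt_eqF ?rho0_gt0 // expR_lt1 pmulr_llt0 ?ln_gt0 //.
rewrite pmulr_llt0 ?invr_gt0 ?ltr0n // /defect subr_lt0 ltr_pdivlMr //.
by rewrite mul1r.
Qed.

Lemma scaleS s i : scale s i.+1 = scale s i * a i `^ defect s / ratio s.
Proof.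
rewrite /scale big_ord_recr /= powRM ?prodr_ge0 // ?ltW //.
  by rewrite exprSr invfM; ring.
by move=> j _; exact: ltW.
Qed.

(** The rescaling closes up after one period; this is what dictates the k-th root in [ratio]. *)
Lemma scale_period s : scale s k = scale s 0.
Proof.
rewrite /scale big_ord0 powR1 invr1 mulr1 /ratio -powR_mulrn ?powR_ge0 //.
rewrite -powRrM divfK ?pnatr_eq0 -?lt0n //.
by rewrite divff // gt_eqF // powR_gt0 // rho0_gt0.
Qed.

Lemma scale_ordS s (i : 'I_k) :
  scale s (ordS i) = scale s i * a i `^ defect s / ratio s.
Proof.
rewrite -scaleS /=; have := ltn_ord i; rewrite leq_eqVlt => /orP[/eqP->|?].
  by rewrite modnn scale_period.
by rewrite modn_small.
Qed.

(** The matrix P of the linear system: one step down the diagram, with levels taken modulo [k]. *)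
Definition trans (p q : 'I_k * V) : R :=
  if q.1 == ordS p.1 then (A p.1 p.2 q.2)%:R / a p.1 else 0.

Lemma trans_ge0 p q : 0 <= trans p q.
Proof. by rewrite /trans; case: ifP => // _; rewrite divr_ge0 // ltW. Qed.

Lemma sum_trans p (G : 'I_k * V -> R) :
  \sum_q trans p q * G q = \sum_u (A p.1 p.2 u)%:R / a p.1 * G (ordS p.1, u).
Proof.
rewrite (eq_bigr (fun q => trans p (q.1, q.2) * G (q.1, q.2))); last by case.
rewrite -(pair_bigA _ (fun i u => trans p (i, u) * G (i, u))) /=.
rewrite (bigD1 (ordS p.1)) //= [X in _ + X]big1 ?addr0 => [|i ip].
  by apply: eq_bigr => u _; rewrite /trans /= eqxx.
by rewrite big1 // => u _; rewrite /trans /= (negPf ip) mul0r.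
Qed.

Lemma trans_x p : \sum_q trans p q * x q.2 = x p.2.
Proof.
rewrite (sum_trans p (fun q => x q.2)) /=; under eq_bigr do rewrite mulrAC.
by rewrite -mulr_suml Ax mulrAC divff ?gt_eqF // mul1r.
Qed.

Definition scaled_zeta chi s (p : 'I_k * V) : \bar R :=
  ((scale s p.1)%:E * path_zeta chi s p.1 p.2)%E.

Lemma scaled_zeta_ge0 chi s p : (0 <= scaled_zeta chi s p)%E.
Proof. by rewrite mule_ge0 ?path_zeta_ge0 // lee_fin ltW // scale_gt0. Qed.

(** The system Y = H + z P Y. It is stated in the extended reals because both finiteness and
    divergence are deduced from it. *)
Lemma scaled_zeta_step chi s p : scaled_zeta chi s p =
  ((scale s p.1 * (if chi 0 then x p.2 `^ s else 0))%:E + (ratio s)%:E *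
    \sum_u ((A p.1 p.2 u)%:R / a p.1)%:E * scaled_zeta (chi \o succn) s (ordS p.1, u))%E.
Proof.
have Z0 (i : 'I_k) u : (0 <= path_zeta (chi \o succn) s i.+1 u)%E by exact: path_zeta_ge0.
have c0 (i : 'I_k) u : 0 <= (A i p.2 u)%:R * a i `^ (- (s / delta)).
  by rewrite mulr_ge0 // powR_ge0.
rewrite /scaled_zeta path_zeta_step ge0_muleDr; last 2 first.
- by rewrite lee_fin; case: ifP => // _; exact: powR_ge0.
- by apply: sume_ge0 => u _; rewrite mule_ge0 // lee_fin.
rewrite -EFinM; congr (_ + _)%E.
rewrite !ge0_sume_distrr; last 2 first.
- by move=> u _; rewrite mule_ge0 ?scaled_zeta_ge0 // lee_fin divr_ge0 // ltW.
- by move=> u _; rewrite mule_ge0 // lee_fin.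
apply: eq_bigr => u _ /=.
rewrite (@path_zeta_mod _ _ p.1.+1 (p.1.+1 %% k)) ?modn_mod // !muleA -!EFinM.
congr (_%:E * _)%E; rewrite scale_ordS /defect powRD; last first.
  by rewrite (gt_eqF (a_gt0 _)) implybT.
rewrite powRr1 ?ltW //.
by field; rewrite !gt_eqF ?ratio_gt0.
Qed.

(** The bound solves the system with source [C * x], so the recursion preserves it. Truncations are
    essential: the constant +oo also satisfies the recursion of the full series. *)
Lemma scaled_zeta_lt_bound s C N p : delta < s ->
  (forall p : 'I_k * V, scale s p.1 * x p.2 `^ s <= C * x p.2) ->
  (scaled_zeta (fun n => n < N)%N s p <= (C / (1 - ratio s) * x p.2)%:E)%E.
Proof.
rewrite -ratio_lt1 => z1 HC.
have C0 : 0 <= C.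
  have := HC p; rewrite -ler_pdivrMr //; apply: le_trans.
  exact/ltW/scaled_vertex_gt0.
elim: N p => [|N IH] p.
  rewrite /scaled_zeta /path_zeta esum1 // mule0 lee_fin.
  by rewrite mulr_ge0 ?divr_ge0 ?subr_ge0 // ltW.
rewrite scaled_zeta_step /=.
have -> : C / (1 - ratio s) * x p.2 = C * x p.2 +
    ratio s * \sum_u (A p.1 p.2 u)%:R / a p.1 * (C / (1 - ratio s) * x u).
  have -> : \sum_u (A p.1 p.2 u)%:R / a p.1 * (C / (1 - ratio s) * x u) =
      C / (1 - ratio s) * x p.2.
    rewrite -[in RHS](trans_x p) (sum_trans p (fun q => x q.2)) mulr_sumr.
    by apply: eq_bigr => u _; rewrite mulrCA.
  by field; rewrite subr_eq0 gt_eqF.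
rewrite EFinD leeD ?lee_fin // EFinM lee_pmul2l ?lte_fin ?ratio_gt0 //.
rewrite -sumEFin; apply: lee_sum => u _; rewrite [leRHS]EFinM.
apply: lee_wpmul2l; first by rewrite lee_fin divr_ge0 // ltW.
exact: (IH (ordS p.1, u)).
Qed.

(** A finite set of paths has bounded length, hence is seen by some truncation. *)
Lemma path_zeta_le_bound s l v B :
  (forall N, path_zeta (fun n => n < N)%N s l v <= B)%E ->
  (path_zeta xpredT s l v <= B)%E.
Proof.
move=> HB; apply: ge_ereal_sup => _ [X [finX XP] <-].
pose N := (\max_(q <- fset_set X) size q)%N.+1.
apply: (@le_trans _ _ (path_zeta (fun n => n < N)%N s l v)) => //.
apply: esum_ge; exists X => //; rewrite !fsbig_finite //=.
rewrite big_seq [leRHS]big_seq; apply: lee_sum => q qX.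
by rewrite ifT // ltnS; exact: leq_bigmax_seq.
Qed.

Lemma path_zeta_lty s l v : delta < s -> (path_zeta xpredT s l v < +oo)%E.
Proof.
move=> sd; rewrite (@path_zeta_mod _ _ l (l %% k)) ?modn_mod //.
pose i : 'I_k := Ordinal (ltn_pmod l k_gt0).
pose C := \sum_(p : 'I_k * V) scale s p.1 * x p.2 `^ s / x p.2.
have HC (p : 'I_k * V) : scale s p.1 * x p.2 `^ s <= C * x p.2.
  rewrite -ler_pdivrMr // /C (bigD1 p) //= lerDl sumr_ge0 // => q _.
  exact/ltW/scaled_vertex_gt0.
pose B := (scale s i)^-1 * (C / (1 - ratio s) * x v).
apply: (@le_lt_trans _ _ B%:E); last exact: ltry.
apply: path_zeta_le_bound => N.
rewrite EFinM -lee_pdivrMl ?invrK ?invr_gt0 ?scale_gt0 //.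
exact: (scaled_zeta_lt_bound N (i, v) sd HC).
Qed.

(** Here z >= 1 and P fixes [x], so each use of the recursion adds at least another [m * x] to the
    lower bound. *)
Lemma path_zeta_y s l v : s <= delta -> path_zeta xpredT s l v = +oo%E.
Proof.
rewrite leNgt -ratio_lt1 -leNgt => z1;
  rewrite (@path_zeta_mod _ _ l (l %% k)) ?modn_mod //.
pose i : 'I_k := Ordinal (ltn_pmod l k_gt0).
have [m m0 mle] := pos_lower_bound (scaled_vertex_gt0 s).
have {}mle (p : 'I_k * V) : m * x p.2 <= scale s p.1 * x p.2 `^ s.
  by rewrite -ler_pdivlMr.
have HN : forall N (p : 'I_k * V), ((N%:R * m * x p.2)%:E <= scaled_zeta xpredT s p)%E.
  elim=> [|N IH] p; first by rewrite !mul0r scaled_zeta_ge0.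
  rewrite scaled_zeta_step /= -natr1.
  apply: (@le_trans _ _ ((m * x p.2)%:E + (ratio s)%:E * (N%:R * m * x p.2)%:E)%E).
    rewrite -EFinM -EFinD lee_fin !mulrDl mul1r addrC lerD2l ler_peMl //.
    by rewrite !mulr_ge0 // ltW.
  rewrite leeD ?lee_fin // lee_pmul2l ?lte_fin ?ratio_gt0 //.
  rewrite -[X in _ * x X](_ : (p.1, p.2).2 = _) //.
  rewrite -(trans_x p) (sum_trans p (fun q => x q.2)) mulr_sumr -sumEFin.
  apply: lee_sum => u _; rewrite mulrCA [leLHS]EFinM.
  apply: lee_wpmul2l; first by rewrite lee_fin divr_ge0 // ltW.
  exact: (IH (ordS p.1, u)).
suff : scaled_zeta xpredT s (i, v) = +oo%E.
  have := path_zeta_ge0 xpredT s (l %% k) v.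
  by rewrite /scaled_zeta /=; case: (path_zeta xpredT s _ v).
apply/eqyP => B B0.
apply: le_trans (HN (Num.trunc (B / (m * x v))).+1 (i, v)).
rewrite lee_fin -mulrA -ler_pdivrMr ?mulr_gt0 //.
exact/ltW/truncnS_gt.
Qed.

Lemma defect_cvg : defect s @[s --> delta^'+] --> (0 : R).
Proof.
apply: cvg_at_right_filter; rewrite /defect.
suff : 1 - s / delta @[s --> delta] --> 1 - delta / delta.
  by rewrite divff ?subrr // gt_eqF.
apply: cvgB; first exact: cvg_cst.
apply: cvgM; last exact: cvg_cst.
exact: cvg_id.
Qed.

Lemma ratio_cvg : ratio s @[s --> delta^'+] --> (1 : R).
Proof.
rewrite -(powRr0 rho0); apply: cvg_powR_exponent; first exact: rho0_gt0.
by rewrite -(mul0r k%:R^-1); apply: cvgM; [exact: defect_cvg|exact: cvg_cst].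
Qed.

Lemma scale_cvg i : scale s i @[s --> delta^'+] --> (1 : R).
Proof.
rewrite -[1]mulr1; apply: cvgM.
  suff : (\prod_(j < i) a j) `^ defect s @[s --> delta^'+] --> (\prod_(j < i) a j) `^ 0.
    by rewrite powRr0.
  by apply: cvg_powR_exponent; [exact: prodr_gt0|exact: defect_cvg].
rewrite -[1]invr1; apply: cvgV; first exact: oner_neq0.
elim: i => [|i IH]; first by under eq_fun do rewrite expr0; exact: cvg_cst.
by under eq_fun do rewrite exprS; rewrite -[1]mulr1; apply: cvgM; [exact: ratio_cvg|].
Qed.

Lemma ratio_near : \forall s \near delta^'+, 0 <= ratio s < 1.
Proof.
near=> s; rewrite (ltW (ratio_gt0 s)) ratio_lt1 /=; near: s; exact: nbhs_right_gt.
Unshelve. all: by end_near. Qed.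

Lemma path_zeta_fin s l v : delta < s -> path_zeta xpredT s l v \is a fin_num.
Proof. by move=> sd; rewrite ge0_fin_numE ?path_zeta_lty // path_zeta_ge0. Qed.

Lemma path_zeta_pole l v : exists2 kappa : R, 0 < kappa &
  (1 - ratio s) * fine (path_zeta xpredT s l v) @[s --> delta^'+] --> kappa.
Proof.
pose i : 'I_k := Ordinal (ltn_pmod l k_gt0).
pose Y s (p : 'I_k * V) := fine (scaled_zeta xpredT s p).
pose H s (p : 'I_k * V) := scale s p.1 * x p.2 `^ s.
pose h (p : 'I_k * V) := x p.2 `^ delta.
have h0 p : 0 < h p by exact: powR_gt0.
have YE : \forall s \near delta^'+,
    forall p, Y s p = H s p + ratio s * \sum_q trans p q * Y s q.
  near=> s => p.
  have sd : delta < s by near: s; exact: nbhs_right_gt.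
  have YK q : scaled_zeta xpredT s q = (Y s q)%:E.
    by rewrite fineK // fin_numM // path_zeta_fin.
  apply: EFin_inj; rewrite -YK scaled_zeta_step /= EFinD; congr (_ + _)%E.
  rewrite EFinM; congr (_ * _)%E.
  rewrite sum_trans -sumEFin; apply: eq_bigr => u _.
  by rewrite [RHS]EFinM -YK.
have Hh p : H s p @[s --> delta^'+] --> h p.
  rewrite -[h p]mul1r; apply: cvgM; first exact: scale_cvg.
  by apply: cvg_powR_exponent => //; apply: cvg_at_right_filter; exact: cvg_id.
have [K KY] := abel_limit trans_ge0 (fun q =>
  x_gt0 q.2) trans_x ratio_near ratio_cvg YE Hh.
(* Halving leaves room for [H s], which only tends to [h], to stay above [m * x] near [delta]. *)
have [m m0 mle] : exists2 m, 0 < m & forall p, m <= h p / 2 / x p.2.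
  by apply: pos_lower_bound => p; rewrite !divr_gt0.
have mH : \forall s \near delta^'+, forall p, m * x p.2 <= H s p.
  apply: filter_forall => p.
  have hp2 : h p / 2 < h p by have := h0 p; lra.
  apply: filterS (cvgr_gt _ (Hh p) _ hp2) => s /ltW; apply: le_trans.
  by rewrite -ler_pdivlMr.
have YC := abel_mean_ge trans_ge0 (fun q => x_gt0 q.2) trans_x ratio_near YE mH.
have Kge : m * x v <= K (i, v).
  rewrite -(cvg_lim _ (KY (i, v))) //; apply: limr_ge; first exact: cvgP (KY _).
  near=> s; suff : forall p, m * x p.2 <= (1 - ratio s) * Y s p by move/(_ (i, v)).
  near: s; exact: YC.
exists (K (i, v)); first by apply: lt_le_trans Kge; rewrite mulr_gt0.
have -> : (fun s => (1 - ratio s) * fine (path_zeta xpredT s l v)) =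
    (fun s => (1 - ratio s) * Y s (i, v) / scale s i).
  apply/funext => s; rewrite -mulrA; congr (_ * _).
  rewrite /Y /scaled_zeta -(@path_zeta_mod _ _ l i) ?modn_mod //=.
  (* Where the series is infinite, [fine] gives 0 on both sides, so the identity holds for every
     [s]. *)
  have := scale_gt0 s i; rewrite /=; case: path_zeta => [r||] /= c0.
  - by rewrite mulrAC divff ?mul1r // gt_eqF.
  - by rewrite gt0_muley ?lte_fin //= mul0r.
  - by rewrite gt0_muleNy ?lte_fin //= mul0r.
rewrite -[K _]divr1; apply: cvgM => //; apply: cvgV; first exact: oner_neq0.
exact: scale_cvg.
Unshelve. all: by end_near. Qed.

(** The part of a weighted trace carried by the paths extending [r]. The factor [phi] is a function
    of finite paths because the points picked by a choice function depend on the path. *)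
Definition twisted_zeta (phi : V -> seq (edge V) -> R) s v r : \bar R :=
  \esum_(q in paths_from A (size r) (pend v r))
    (path_weight 0 v (r ++ q) `^ s * phi v (r ++ q))%:E.

Section twisted.
Variables (phi : V -> seq (edge V) -> R) (M : R).
Hypotheses (phi_ge0 : forall v r, 0 <= phi v r) (phi_le : forall v r, phi v r <= M).

Lemma twisted_zeta_ge0 s v r : (0 <= twisted_zeta phi s v r)%E.
Proof. by apply: esum_ge0 => q _; rewrite lee_fin mulr_ge0 // powR_ge0. Qed.

Lemma twisted_zeta_step s v r : twisted_zeta phi s v r =
  ((path_weight 0 v r `^ s * phi v r)%:E +
   \sum_(e <- out_edges A (size r) (pend v r)) twisted_zeta phi s v (rcons r e))%E.
Proof.
rewrite /twisted_zeta esum_paths_step; last first.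
  by move=> q; rewrite lee_fin mulr_ge0 // powR_ge0.
rewrite cats0; congr (_ + _)%E; apply: eq_bigr => e _.
rewrite size_rcons pend_rcons; apply: eq_esum => q _.
by rewrite cat_rcons.
Qed.
End twisted.

Let one (v : V) (r : seq (edge V)) : R := 1.

Lemma cylinder_zetaE s v r : twisted_zeta one s v r =
  (((\prod_(i < size r) a i) `^ (- (s / delta)))%:E *
   path_zeta xpredT s (size r) (pend v r))%E.
Proof.
rewrite /path_zeta -esumZl ?powR_ge0 //; last first.
  by move=> q; rewrite lee_fin powR_ge0.
apply: eq_esum => q _; rewrite mulr1 path_weight_cat.
rewrite powRM ?powR_ge0 ?(ltW (path_weight_gt0 _ _ _)) // EFinM.
by rewrite -powRrM mulNr (mulrC _^-1).
Qed.

Lemma cylinder_zeta_fin s v r : delta < s -> twisted_zeta one s v r \is a fin_num.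
Proof. by move=> sd; rewrite cylinder_zetaE fin_numM // path_zeta_fin. Qed.

Lemma cylinder_zeta_pole v r : exists2 kappa : R, 0 < kappa &
  (1 - ratio s) * fine (twisted_zeta one s v r) @[s --> delta^'+] --> kappa.
Proof.
have [K K0 KP] := path_zeta_pole (size r) (pend v r).
pose c := \prod_(i < size r) a i.
have c0 : 0 < c by exact: prodr_gt0.
exists (c `^ (- (delta / delta)) * K); first by rewrite mulr_gt0 // powR_gt0.
have Hc : c `^ (- (s / delta)) @[s --> delta^'+] --> c `^ (- (delta / delta)).
  apply: cvg_powR_exponent => //; apply: cvgN; apply: cvgM; last exact: cvg_cst.
  by apply: cvg_at_right_filter; exact: cvg_id.
apply: cvg_trans (cvgM Hc KP); apply: near_eq_cvg; near=> s.
have sd : delta < s by near: s; exact: nbhs_right_gt.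
by rewrite cylinder_zetaE fineM ?path_zeta_fin // mulrCA.
Unshelve. all: by end_near. Qed.

(** * Convergence of weighted means over paths *)

Section weighted_mean.
Variables (phi : V -> seq (edge V) -> R) (M : R).
Hypotheses (phi_ge0 : forall v r, 0 <= phi v r) (phi_le : forall v r, phi v r <= M).

Lemma twisted_zeta_fin s v r : delta < s -> twisted_zeta phi s v r \is a fin_num.
Proof.
move=> sd; rewrite ge0_fin_numE ?twisted_zeta_ge0 //.
have M0 : 0 <= M := le_trans (phi_ge0 v r) (phi_le v r).
apply: (@le_lt_trans _ _ (M%:E * twisted_zeta one s v r)%E); last first.
  by rewrite ltey_eq fin_numM // cylinder_zeta_fin.
rewrite -esumZl //; last by move=> q; rewrite lee_fin mulr1 powR_ge0.
by apply: le_esum => q _; rewrite -EFinM lee_fin mulr1 mulrC ler_wpM2r // powR_ge0.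
Qed.

Lemma twisted_zeta_osc s v r e : delta < s ->
  (forall q, is_path A (size r) (pend v r) q -> `|phi v (r ++ q) - phi v r| <= e) ->
  0 <= e ->
  `|fine (twisted_zeta phi s v r) - phi v r * fine (twisted_zeta one s v r)|
    <= e * fine (twisted_zeta one s v r).
Proof.
move=> sd osc e0.
have F0 q : (0 <= (path_weight 0 v (r ++ q) `^ s * one v (r ++ q))%:E)%E.
  by rewrite lee_fin mulr1 powR_ge0.
have F1 q : (0 <= (path_weight 0 v (r ++ q) `^ s * phi v (r ++ q))%:E)%E.
  by rewrite lee_fin mulr_ge0 // powR_ge0.
have U1 := cylinder_zeta_fin v r sd; have Uphi := twisted_zeta_fin v r sd.
rewrite ler_norml; apply/andP; split.
  (* Both sides become sums of nonnegative terms, which [esum] can compare term by term. *)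
  rewrite lerBrDl lerBlDr.
  rewrite -lee_fin EFinD !EFinM !fineK //.
  rewrite -!esumZl // -esumD //; last by move=> q _; rewrite mule_ge0.
  apply: le_esum => q /osc; rewrite ler_norml => /andP[+ _].
  rewrite -!EFinM -EFinD lee_fin mulr1 (mulrC (phi v r)) (mulrC e) -mulrDr => H.
  by rewrite ler_wpM2l ?powR_ge0 //; lra.
rewrite lerBlDr -mulrDl -lee_fin EFinM !fineK // -esumZl ?addr_ge0 //.
apply: le_esum => q /osc; rewrite ler_norml => /andP[_ H].
by rewrite -!EFinM lee_fin mulr1 mulrC ler_wpM2r ?powR_ge0 //; lra.
Qed.

Hypothesis osc : forall e, 0 < e -> forall y : inf_path A, exists n, forall q,
  is_path A 0 (erng (y 0%N)) (mkseq y n ++ q) ->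
  `|phi (erng (y 0%N)) (mkseq y n ++ q) - phi (erng (y 0%N)) (mkseq y n)| <= e.

Lemma one_sub_ratio_near : \forall s \near delta^'+, 0 < 1 - ratio s.
Proof.
near=> s; rewrite subr_gt0 ratio_lt1; near: s; exact: nbhs_right_gt.
Unshelve. all: by end_near. Qed.

(** At a bar, [phi] is within [e] of a constant on all extensions and the mass of the cylinder has a
    limit after multiplication by 1 - z. Below the bar length, the contributions of the children add
    up, and the single term of the path itself is killed by 1 - z. *)
Lemma twisted_zeta_almost_cvg e v : 0 < e ->
  almost_cvg delta^'+ (fun s => 1 - ratio s) e
    (fun s => fine (twisted_zeta phi s v [::])) (fun s =>
      fine (twisted_zeta one s v [::])).
Proof.
move=> e0; have lam_ge0 : \forall s \near delta^'+, 0 <= 1 - ratio s.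
  by apply: filterS one_sub_ratio_near => s /ltW.
pose Q v r := is_path A 0 v r -> almost_cvg delta^'+ (fun s => 1 - ratio s) e
  (fun s => fine (twisted_zeta phi s v r)) (fun s => fine (twisted_zeta one s v r)).
suff : Q v [::] by apply.
apply: (@bar_induction V A Q) => [y|{}v r rP IH _].
  have [n nP] := osc e0 y; exists n => rP.
  have [K _ KP] := cylinder_zeta_pole (erng (y 0%N)) (mkseq y n).
  apply: (almost_cvg_dominated (c := phi (erng (y 0%N)) (mkseq y n)) lam_ge0 KP).
  near=> s; apply: twisted_zeta_osc; last exact: ltW.
    by near: s; exact: nbhs_right_gt.
  by move=> q qP; apply: nP; rewrite is_path_cat rP.
pose c := path_weight 0 v r; have c0 : 0 < c := path_weight_gt0 _ _ _.
have step psi N s : (forall v r, 0 <= psi v r :> R) -> (forall v r,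
  psi v r <= N) -> delta < s ->
    (forall v r, twisted_zeta psi s v r \is a fin_num) ->
    c `^ s * psi v r + \sum_(e <- out_edges A (size r) (pend v r))
      fine (twisted_zeta psi s v (rcons r e)) = fine (twisted_zeta psi s v r).
  move=> psi0 psiN sd psifin; rewrite twisted_zeta_step //.
  rewrite fineD ?sum_fine //=.
  by rewrite -EFin_sum_fine.
have sum_cvg : almost_cvg delta^'+ (fun s => 1 - ratio s) e
    (fun s => \sum_(e' <- out_edges A (size r) (pend v r))
       fine (twisted_zeta phi s v (rcons r e')))
    (fun s => \sum_(e' <- out_edges A (size r) (pend v r))
       fine (twisted_zeta one s v (rcons r e'))).
  apply: almost_cvg_sum => e' e'E; apply: IH => //.
  by rewrite is_path_rcons rP add0n; rewrite mem_out_edges in e'E.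
have vertex_cvg : almost_cvg delta^'+ (fun s => 1 - ratio s) e
    (fun s => c `^ s * phi v r) (fun s => c `^ s * one v r).
  apply: almost_cvg0 => //; [exact: ltW| |by apply: nearW => s; rewrite mulr1 powR_ge0].
  rewrite -(mul0r (c `^ delta * phi v r)) -(subrr 1).
  apply: cvgM; first by apply: cvgB; [exact: cvg_cst|exact: ratio_cvg].
  apply: cvgM; last exact: cvg_cst.
  by apply: cvg_powR_exponent => //; apply: cvg_at_right_filter; exact: cvg_id.
apply: almost_cvg_ext (almost_cvgD vertex_cvg sum_cvg).
near=> s; have sd : delta < s by near: s; exact: nbhs_right_gt.
split; first by apply: step => // *; exact: twisted_zeta_fin.
by apply: (step _ 1) => //= *; exact: cylinder_zeta_fin.
Unshelve. all: by end_near. Qed.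

Theorem weighted_mean_cvg : inhabited V -> cvg (
  (\sum_v fine (twisted_zeta phi s v [::])) / (\sum_v fine (twisted_zeta one s v [::]))
    @[s --> delta^'+]).
Proof.
move=> [v0]; have /choice[K KP] : forall v, exists kappa : R, 0 < kappa /\
    ((1 - ratio s) * fine (twisted_zeta one s v [::]) @[s --> delta^'+] --> kappa).
  by move=> v; have [K] := cylinder_zeta_pole v [::]; exists K.
apply: (almost_cvg_ratio (k := \sum_v K v) _ _ one_sub_ratio_near).
- rewrite (bigD1 v0) //= ltr_wpDr ?(KP v0).1 // sumr_ge0 // => v _.
  exact: ltW (KP v).1.
- under eq_fun do rewrite mulr_sumr.
  by apply: cvg_big => [|v _]; [exact: add_continuous|exact: (KP v).2].
- move=> e e0; apply: almost_cvg_sum => v _; exact: twisted_zeta_almost_cvg.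
Qed.
End weighted_mean.
Lemma esum_twisted_zeta (H : fin_path A * 'I_2 -> R) s : (forall p, 0 <= H p) ->
  (\esum_(p in [set: fin_path A * 'I_2])
     (path_weight 0 (val p.1).1 (val p.1).2 `^ s * H p)%:E =
   \sum_v twisted_zeta (path_extension H) s v [::])%E.
Proof.
move=> H0; rewrite /twisted_zeta /=.
rewrite -(@esum_fin_path R V A (fun v r =>
  (path_weight 0 v r `^ s * path_extension H v r)%:E)); last first.
  move=> v r; rewrite lee_fin mulr_ge0 ?powR_ge0 //.
  by apply: (@path_extensionP R V A (fun t => 0 <= t)) => // l _; rewrite addr_ge0.
transitivity (\esum_(l in [set: fin_path A]) \esum_(b in [set: 'I_2])
   (path_weight 0 (val l).1 (val l).2 `^ s * H (l, b))%:E)%E.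
  rewrite esum_esum; last by move=> l b _ _; rewrite lee_fin mulr_ge0 ?powR_ge0.
  rewrite (_ : _ `*`` _ = setT); last by apply/seteqP; split.
  by apply: eq_esum => -[l b].
apply: eq_esum => l _; rewrite path_extension_val esum_fset; last 2 first.
- exact: finite_finset.
- by move=> b _; rewrite lee_fin mulr_ge0 ?powR_ge0.
rewrite (_ : \sum_(b \in _) _ = \sum_(b < 2)
    (path_weight 0 (val l).1 (val l).2 `^ s * H (l, b))%:E)%E.
  rewrite !big_ord_recl big_ord0 adde0 -EFinD mulrDr.
  have -> : ord0 = 0 :> 'I_2 by exact: val_inj.
  by have -> : lift 0 0 = 1 :> 'I_2 by exact: val_inj.
by rewrite fsbig_setT.
Qed.

Lemma esum_path_weight s :
  (\esum_(p in [set: fin_path A * 'I_2])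
     (path_weight 0 (val p.1).1 (val p.1).2 `^ s)%:E =
   2%:E * \sum_v path_zeta xpredT s 0 v)%E.
Proof.
under eq_esum do rewrite -[_ `^ s]mulr1.
rewrite (@esum_twisted_zeta (fun=> 1)) // ge0_sume_distrr; last first.
  by move=> v _; exact: path_zeta_ge0.
apply: eq_bigr => v _; rewrite /path_zeta -esumZl //; last first.
  by move=> q; rewrite lee_fin powR_ge0.
apply: eq_esum => q qP; rewrite -EFinM mulrC /=; congr (_ * _)%:E.
by rewrite /path_extension insubT.
Qed.

Lemma esum_path_weight_lty s : delta < s ->
  (\esum_(p in [set: fin_path A * 'I_2])
     (path_weight 0 (val p.1).1 (val p.1).2 `^ s)%:E < +oo)%E.
Proof.
move=> sd; rewrite esum_path_weight -EFin_sum_fine; last first.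
  by move=> v _; exact: path_zeta_fin.
by rewrite -EFinM ltry.
Qed.

Lemma esum_path_weight_y s : inhabited V -> s <= delta ->
  \esum_(p in [set: fin_path A * 'I_2])
     (path_weight 0 (val p.1).1 (val p.1).2 `^ s)%:E = +oo%E.
Proof.
move=> [v] sd; rewrite esum_path_weight (bigD1 v) //= path_zeta_y //.
have S0 : (0 <= \sum_(u | u != v) path_zeta xpredT s 0 u)%E.
  by apply: sume_ge0 => u _; exact: path_zeta_ge0.
by rewrite addye ?gt0_muley ?lte_fin // -ltNye (lt_le_trans _ S0) // ltNy0.
Qed.

(** The points chosen for a path lie in its cylinder, so along an infinite path [y] both values of
    [H] approach [g y + M]; this gives the oscillation bound for [phi]. *)
Lemma path_mean_cvg (g : inf_path A -> R) (tau :
  fin_path A -> inf_path A * inf_path A) (M : R) :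
  inhabited V -> locally_uniform g -> (forall y, `|g y| <= M) ->
  (forall l, cylinder l (tau l).1 /\ cylinder l (tau l).2) ->
  cvg ((fine (\esum_(p in [set: fin_path A * 'I_2])
      (path_weight 0 (val p.1).1 (val p.1).2 `^ s * (g (endpoint tau p) + M))%:E) -
     M * fine (\esum_(p in [set: fin_path A * 'I_2])
      (path_weight 0 (val p.1).1 (val p.1).2 `^ s)%:E)) /
     fine (\esum_(p in [set: fin_path A * 'I_2])
      (path_weight 0 (val p.1).1 (val p.1).2 `^ s)%:E) @[s --> delta^'+]).
Proof.
move=> V0 gU gM tauP.
pose H p := g (endpoint tau p) + M.
have HM p : 0 <= H p <= 2 * M.
  by rewrite /H; have := gM (endpoint tau p); rewrite ler_norml => /andP[]; lra.
have H_ge0 p : 0 <= H p by case/andP: (HM p).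
have M0 : 0 <= M.
  have [v] := V0; apply: le_trans (normr_ge0 _) (gM (tau (vpath A v)).1).
pose phi := path_extension H.
have phi_ge0 v r : 0 <= phi v r.
  by apply: (@path_extensionP R V A (fun t => 0 <= t)) => // l _; rewrite addr_ge0.
have phi_le v r : phi v r <= 4 * M.
  apply: (@path_extensionP R V A (fun t => t <= 4 * M)) => [|l _]; first by lra.
  by have /andP[_ h0] := HM (l, 0); have /andP[_ h1] := HM (l, 1); lra.
have phi_osc e : 0 < e -> forall y : inf_path A, exists n, forall q,
    is_path A 0 (erng (y 0%N)) (mkseq y n ++ q) ->
    `|phi (erng (y 0%N)) (mkseq y n ++ q) - phi (erng (y 0%N)) (mkseq y n)| <= e.
  (* Two values add up in [phi], and two paths are each compared with [2 * (g y + M)]. *)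
  move=> e0 y; have e4 : 0 < e / 4 by rewrite divr_gt0.
  have [n nP] := gU _ e4 y; exists n => q qP.
  have near_y r (l : fin_path A) : val l = (erng (y 0%N), mkseq y n ++ r) ->
      `|H (l, 0) - (g y + M)| <= e / 4 /\ `|H (l, 1) - (g y + M)| <= e / 4.
    move=> lE.
    have cyl y' : cylinder l y' -> `|g y' + M - (g y + M)| <= e / 4.
      rewrite /cylinder /= lE => -[ey my]; rewrite (_ : _ - _ = g y' - g y); last by ring.
      apply: nP => //; move: my => /(congr1 (take n)).
      rewrite take_size_cat ?size_mkseq // => <-.
      rewrite /mkseq -map_take take_iota (minn_idPl _) //.
      by rewrite /plen lE size_cat size_mkseq leq_addr.
    by have [c1 c2] := tauP l; split; apply: cyl.
  have phi_near r : is_path A 0 (erng (y 0%N)) (mkseq y n ++ r) ->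
      `|phi (erng (y 0%N)) (mkseq y n ++ r) - 2 * (g y + M)| <= e / 2.
    move=> rP; rewrite /phi /path_extension insubT /=.
    set l : fin_path A := Sub _ _.
    have [] := near_y r l erefl.
    by rewrite !ler_norml => /andP[? ?] /andP[? ?]; apply/andP; split; lra.
  have := phi_near q qP; have := phi_near [::]; rewrite cats0.
  move=> /(_ (inf_path_prefix y n).1).
  by rewrite !ler_norml => /andP[? ?] /andP[? ?]; apply/andP; split; lra.
pose N s := \sum_v fine (twisted_zeta phi s v [::]).
pose Z s := \sum_v fine (twisted_zeta (fun=> fun=> 1) s v [::]).
have : cvg (N s / Z s @[s --> delta^'+]) := weighted_mean_cvg phi_ge0 phi_le phi_osc V0.
(* The denominator counts every path twice, once per basis vector, while [phi] already contains
   both; subtracting [M] undoes the shift. *)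
move=> /cvg_ex[/= l Hl]; apply/cvg_ex; exists (l / 2 - M).
have Hl2 : N s / Z s / 2 - M @[s --> delta^'+] --> l / 2 - M.
  by apply: cvgB; [apply: cvgM => //; exact: cvg_cst|exact: cvg_cst].
apply: cvg_trans Hl2; apply: near_eq_cvg; near=> s.
have sd : delta < s by near: s; exact: nbhs_right_gt.
have D_E : fine (\esum_(p in [set: fin_path A * 'I_2])
      (path_weight 0 (val p.1).1 (val p.1).2 `^ s)%:E) = 2 * Z s.
  rewrite esum_path_weight fineM //; last first.
    by rewrite -EFin_sum_fine // => v _; exact: path_zeta_fin.
  congr (_ * _); rewrite -sum_fine; last by move=> v _; exact: path_zeta_fin.
  by apply: eq_bigr => v _; rewrite cylinder_zetaE /= big_ord0 powR1 mul1e.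
have Z0 : 0 < Z s.
  have Zlt v : 0 < fine (twisted_zeta (fun=> fun=> 1) s v [::]).
    rewrite -lte_fin fineK; last exact: cylinder_zeta_fin.
    apply: (@lt_le_trans _ _ (path_weight 0 v [::] `^ s)%:E).
      by rewrite lte_fin powR_gt0 // path_weight_gt0.
    apply: esum_ge; exists [set [::]]; first by split => // q ->.
    by rewrite fsbig_set1 /= mulr1.
  have [v] := V0; rewrite /Z (bigD1 v) //= ltr_wpDr // sumr_ge0 // => u _.
  exact: ltW.
rewrite D_E (esum_twisted_zeta _ H_ge0) -sum_fine; last first.
  by move=> v _; exact: twisted_zeta_fin.
rewrite -/(N s) mulrBl; congr (_ - _); last by field; rewrite gt_eqF.
by field; rewrite gt_eqF.
Unshelve. all: by end_near. Qed.
End periodic_weights.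

(** * The stationary diagram of a k-graph *)

(** One more edge raises a single exponent. At the end of a period the quotient grows by one while
    the remainder returns to 0. *)
Lemma divnS_addb k n i : (i < k)%N ->
  (n.+1 %/ k + (i < n.+1 %% k) = n %/ k + (i < n %% k) + (i == n %% k))%N.
Proof.
move=> ik; have k0 : (0 < k)%N by case: k ik.
pose q := (n %/ k)%N; pose t := (n %% k)%N.
have nE : n.+1 = (q * k + t.+1)%N by rewrite addnS -divn_eq.
have tk : (t < k)%N := ltn_pmod n k0.
rewrite nE -/q -/t divnMDl // modnMDl; have [tk'|kt] := ltnP t.+1 k.
  rewrite divn_small // modn_small // addn0 ltnS leq_eqVlt -addnA.
  by case: ltngtP.
have -> : t.+1 = k by apply/eqP; rewrite eqn_leq tk.
rewrite divnn k0 modnn ltn0 addn0 -addnA; congr (_ + _)%N.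
by case: ltngtP kt => // ti; rewrite leqNgt (leq_ltn_trans ti ik).
Qed.

(** Matches the closed exponents of [w_delta] with the edge-by-edge product of [path_weight]. *)
Lemma prod_periodic (R : comNzRingType) (b : nat -> R) k n : (0 < k)%N ->
  \prod_(i < k) b i ^+ (n %/ k + (i < n %% k)) = \prod_(j < n) b (j %% k)%N.
Proof.
move=> k0; elim: n => [|n IH].
  by rewrite big_ord0 big1 // => i _; rewrite div0n mod0n.
rewrite big_ord_recr /= -IH.
under eq_bigr => i _ do rewrite divnS_addb // exprD.
rewrite big_split /=; congr (_ * _).
rewrite (bigD1 (Ordinal (ltn_pmod n k0))) //= eqxx expr1 big1 ?mulr1 // => i ni.
by rewrite (_ : (i == n %% k :> nat)%N = false) //; apply: negPf.
Qed.

Section stationary.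
Variables (R : realType) (k : nat) (V : finType) (L : kgraph k V) (x :
  V -> R) (delta : R).
Hypotheses (k_gt0 : (0 < k)%N) (pf : perron_frobenius L x) (delta_gt0 : 0 < delta).
Hypothesis ww : is_weight (@w_delta R k V L x delta).
Hypothesis wdiam : forall l : fin_path (kbratteli L),
  w_delta x delta l = diam (@d_delta R k V L x delta) l.

Let a l := rho R L (l %% k)%N.

Lemma w_deltaE (l : fin_path (kbratteli L)) :
  w_delta x delta l = path_weight a x delta 0 (val l).1 (val l).2.
Proof.
by rewrite /w_delta /path_weight prod_periodic.
Qed.

Lemma perron_frobenius_inhabited : inhabited V.
Proof.
have [_ x1 _] := pf; have [v _|V0] := pickP [pred v : V | true]; first by constructor.
by move: x1; rewrite big_pred0 // => /eqP; rewrite eq_sym oner_eq0.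
Qed.

(** Otherwise every diameter would be the supremum of the empty set, which is 0 by convention,
    against the positivity of the weights. *)
Lemma kbratteli_inf_path : inhabited (inf_path (kbratteli L)).
Proof.
have [v] := perron_frobenius_inhabited; have [w0 _ _ _] := ww.
apply: contrapT => noX; have := w0 (vpath (kbratteli L) v); rewrite wdiam /diam.
rewrite (_ : [set _ | _ in _ & _ in _] = set0) ?sup0 ?ltxx //.
by apply/seteqP; split => // r [y _]; exfalso; apply: noX.
Qed.

Definition inf_path_take (A : nat -> V -> V -> nat) (y : inf_path A) n : fin_path A :=
  exist _ (erng (y 0%N), mkseq y n) (inf_path_prefix y n).1.

Lemma plen_inf_path_take (A : nat -> V -> V -> nat) (y : inf_path A) n :
  plen (inf_path_take y n) = n.
Proof. exact: size_mkseq. Qed.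

(** Nonnegativity follows from the eigenvector equation. A zero factor would make the weight of a
    path of length [k] vanish, because [powR] sends the base 0 to 0 even for a negative exponent. *)
Lemma rho_gt0 i : (i < k)%N -> 0 < rho R L i.
Proof.
move=> ik; have [v] := perron_frobenius_inhabited; have [x0 _ Ax] := pf.
rewrite lt0r; apply/andP; split; last first.
  rewrite -(pmulr_lge0 _ (x0 v)) -(Ax (Ordinal ik)) /=; apply: sumr_ge0 => u _.
  by rewrite mulr_ge0 // ltW.
have [y] := kbratteli_inf_path; have [w0 _ _ _] := ww.
have := w0 (inf_path_take y k); rewrite pmulr_lgt0 //.
rewrite plen_inf_path_take divnn k_gt0 modnn.
apply: contraTneq => rho0;
  rewrite (bigD1 (Ordinal ik)) //= rho0 expr1 mul0r powR0 ?ltxx //.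
by rewrite oppr_eq0 invr_eq0 gt_eqF.
Qed.

(** Ensures that the suprema in [is_weight] are taken over bounded sets and so bound their
    elements. *)
Lemma w_delta_le1 (l : fin_path (kbratteli L)) : w_delta x delta l <= 1.
Proof.
have [w0 w1 _ wmono] := ww; set v := (val l).1.
have wv : w_delta x delta (vpath (kbratteli L) v) <= 1.
  apply: le_trans w1; rewrite (bigD1 v) //= lerDl sumr_ge0 // => u _.
  exact: ltW.
have [<-//|vl] := eqVneq (vpath (kbratteli L) v) l.
by apply: ltW; apply: lt_le_trans wv; apply: wmono;
  rewrite /proper_prefix /= eqxx prefix0s vl.
Qed.

(** If the product were at most 1, paths of length [N * k] would weigh at least the smallest entries
    of [x], for every [N], and the weights could not tend to 0. *)
Lemma prod_rho_gt1 : 1 < \prod_(i < k) a i.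
Proof.
have [x0 _ _] := pf; have [w0 _ wlim _] := ww; have [y] := kbratteli_inf_path.
have aE : \prod_(i < k) a i = \prod_(i < k) rho R L i.
  by apply: eq_bigr => i _; rewrite /a modn_small.
rewrite aE ltNge; apply/negP => rho_le1.
have rho_gt0' : 0 < \prod_(i < k) rho R L i by apply: prodr_gt0 => i _; exact: rho_gt0.
have [m m0 mx] := pos_lower_bound x0.
have /cvgrPdist_lt /(_ _ m0) [N _ NP] := wlim.
have := NP (N * k)%N (leq_pmulr N k_gt0).
rewrite sub0r normrN; apply/negP; rewrite -leNgt; apply: le_trans (ler_norm _).
apply: (@le_trans _ _ (w_delta x delta (inf_path_take y (N * k)))); last first.
  apply: ub_le_sup; last first.
    by exists (inf_path_take y (N * k)); first exact: plen_inf_path_take.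
  by exists 1 => _ [l _ <-]; exact: w_delta_le1.
rewrite /w_delta; set v := psrc _; apply: le_trans (mx v) _.
apply: ler_peMl; first exact: ltW (x0 v).
rewrite plen_inf_path_take modnMl (mulnK _ k_gt0).
under eq_bigr do rewrite ltn0 addn0.
rewrite prodrXl; set r := (_ ^+ _).
have r0 : 0 < r by rewrite exprn_gt0.
have r1 : r <= 1 by rewrite (exprn_ile1 _ (ltW rho_gt0')).
rewrite -[leLHS](powRr0 r); apply: ger_powR; first by rewrite r0.
by rewrite oppr_le0 invr_ge0 ltW.
Qed.

Let V_inh := perron_frobenius_inhabited.
Let Aper l : kbratteli L l = kbratteli L (l %% k)%N.
Proof. by rewrite /kbratteli modn_mod. Qed.
Let aper l : a l = a (l %% k)%N.
Proof. by rewrite /a modn_mod. Qed.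
Let a_gt0 l : 0 < a l.
Proof. by rewrite rho_gt0 // ltn_mod. Qed.
Let x_gt0 v : 0 < x v.
Proof. by have [x0 _ _] := pf. Qed.
Let Ax l v : \sum_u (kbratteli L l v u)%:R * x u = a l * x v.
Proof. by have [_ _ H] := pf; exact: (H (Ordinal (ltn_pmod l k_gt0))). Qed.

Let d : inf_path (kbratteli L) -> inf_path (kbratteli L) -> R := d_delta x delta.
Let W s (p : fin_path (kbratteli L) * 'I_2) : R :=
  path_weight a x delta 0 (val p.1).1 (val p.1).2 `^ s.

Lemma abs_dirac_pow_stationary s l : abs_dirac_pow d s l =
  (real_complex R (path_weight a x delta 0 (val l).1 (val l).2 `^ s))%:M.
Proof.
by rewrite abs_dirac_powE -wdiam w_deltaE // path_weight_gt0.
Qed.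

Lemma zeta_stationary s : zeta d s =
  ((2^-1)%:E * \esum_(p in [set: fin_path (kbratteli L) * 'I_2]) (W s p)%:E)%E.
Proof.
congr (_ * _)%E; apply: eq_esum => p _.
by rewrite abs_dirac_pow_stationary mxE eqxx mulr1n.
Qed.

Lemma abscissa_stationary : is_abscissa d delta.
Proof.
have zetaE s : (zeta d s < +oo)%E = (delta < s).
  rewrite zeta_stationary; apply/idP/idP => [|sd].
    apply: contraTT; rewrite -leNgt => sd.
    rewrite (esum_path_weight_y k_gt0 Aper aper a_gt0 x_gt0 Ax delta_gt0
      prod_rho_gt1 V_inh sd).
    by rewrite gt0_muley ?lte_fin ?invr_gt0.
  have := esum_path_weight_lty k_gt0 Aper aper a_gt0 x_gt0 Ax delta_gt0 prod_rho_gt1 sd.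
  move=> H; rewrite ltey_eq fin_numM // ge0_fin_numE // esum_ge0 // => p _.
  by rewrite lee_fin powR_ge0.
apply/eqP; rewrite eq_le; apply/andP; split; last first.
  by apply: le_ereal_inf_tmp => _ [s [_ +] <-]; rewrite zetaE lee_fin => /ltW.
apply/lee_addgt0Pr => e e0; apply: ge_ereal_inf; exists (delta + e)%:E => //.
by exists (delta + e) => //; split; [rewrite addr_gt0|rewrite zetaE ltrDl].
Qed.

Lemma trace_stationary (T : block_op R (kbratteli L)) s (u :
  fin_path (kbratteli L) * 'I_2 -> R[i]) (M : R) :
  delta < s ->
  (forall p, T p.1 p.2 p.2 = real_complex R (W s p) * u p) ->
  (forall p, `|complex.Re (u p)| <= M) -> (forall p, `|complex.Im (u p)| <= M) ->
  let D := fine (\esum_(p in [set: fin_path (kbratteli L) * 'I_2]) (W s p)%:E) in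
  let N (g : R[i] -> R) := fine (\esum_(p in [set: fin_path (kbratteli L) * 'I_2])
    (W s p * (g (u p) + M))%:E) in
  trace T = ((N (@complex.Re R) - M * D) +i* (N (@complex.Im R) - M * D))%C.
Proof.
move=> sd TE uR uI D N.
have W0 p : 0 <= W s p by exact: powR_ge0.
have Wfin : (\esum_(p in [set: fin_path (kbratteli L) * 'I_2]) (W s p)%:E < +oo)%E.
  exact: (esum_path_weight_lty k_gt0 Aper aper a_gt0 x_gt0 Ax delta_gt0 prod_rho_gt1 sd).
apply: cvg_lim; first exact: norm_hausdorff.
apply: cvg_complex.
- apply: cvg_trans (bounded_sum_totally_cvg W0 Wfin uR); apply: near_eq_cvg;
    apply: nearW => J.
  rewrite Re_sum; apply: eq_bigr => p _.
  by rewrite TE; case: (u _) => b c /=; rewrite mul0r subr0.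
- apply: cvg_trans (bounded_sum_totally_cvg W0 Wfin uI); apply: near_eq_cvg;
    apply: nearW => J.
  rewrite Im_sum; apply: eq_bigr => p _.
  by rewrite TE; case: (u _) => b c /=; rewrite mul0r addr0.
Qed.

Theorem zeta_regular_stationary : zeta_regular d.
Proof.
exists delta; split; [exact: delta_gt0|exact: abscissa_stationary|].
move=> tau tauP f fc.
have tau_cyl l : cylinder l (tau l).1 /\ cylinder l (tau l).2 by have [] := tauP l.
have [fR fI] := continuous_locally_uniform fc.
have [MR MR0 fMR] := locally_uniform_bounded fR.
have [MI MI0 fMI] := locally_uniform_bounded fI.
(* [trace_stationary] takes one bound for both parts. *)
pose M := MR + MI.
have RM y : `|complex.Re (f y)| <= M by rewrite (le_trans (fMR y)) // lerDl.
have IM y : `|complex.Im (f y)| <= M by rewrite (le_trans (fMI y)) // lerDr.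
have mean g := @path_mean_cvg _ _ _ _ _ _ _ k_gt0 Aper aper a_gt0 x_gt0 Ax delta_gt0
  prod_rho_gt1 g tau M V_inh.
have /cvg_ex[/= lR HR] := mean _ fR RM tau_cyl.
have /cvg_ex[/= lI HI] := mean _ fI IM tau_cyl.
apply/cvg_ex; exists ((lR +i* lI)%C : (R[i])^o).
pose D s := fine (\esum_(p in [set: fin_path (kbratteli L) * 'I_2]) (W s p)%:E).
have numE s : delta < s -> trace (fun g => abs_dirac_pow d s g *m pi_rep tau f g) =
   ((fine (\esum_(p in [set: fin_path (kbratteli L) * 'I_2])
     (W s p * (complex.Re (f (endpoint tau p)) + M))%:E) - M * D s) +i*
   (fine (\esum_(p in [set: fin_path (kbratteli L) * 'I_2])
     (W s p * (complex.Im (f (endpoint tau p)) + M))%:E) - M * D s))%C.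
  move=> sd; apply: (@trace_stationary _ _ (fun p => f (endpoint tau p))) => // -[l b] /=.
  rewrite abs_dirac_pow_stationary mul_scalar_mx !mxE eqxx mulr1n.
  by rewrite /endpoint /=; case: ifP.
have denE s : delta < s -> trace (abs_dirac_pow d s) = real_complex R (D s).
  (* With [u] and [M] equal to 1 the real part is 2 D - D and the imaginary part is D - D. *)
  move=> sd; rewrite (@trace_stationary _ s (fun=> 1) 1) //=.
  - rewrite mul1r; congr (_ +i* _)%C.
      rewrite -/(D s) (_ : esum _ _ = 2%:E * \esum_(p in setT) (W s p)%:E)%E.
        rewrite fineM //; first by rewrite -/(D s); lra.
        have := esum_path_weight_lty k_gt0 Aper aper a_gt0 x_gt0 Ax delta_gt0
          prod_rho_gt1 sd.
        move=> H; rewrite ge0_fin_numE // esum_ge0 // => p _.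
        by rewrite lee_fin powR_ge0.
      rewrite -esumZl //; last by move=> p; rewrite lee_fin powR_ge0.
      by apply: eq_esum => p _; rewrite -EFinM mulrC.
    rewrite -/(D s) (_ : esum _ _ = \esum_(p in setT) (W s p)%:E)%E ?subrr //.
    by apply: eq_esum => p _; rewrite add0r mulr1.
  - by move=> p; rewrite abs_dirac_pow_stationary mxE eqxx mulr1n mulr1.
  - by move=> p; rewrite normr1.
  - by move=> p; rewrite normr0.
have quot (z : R[i]) (r : R) :
  z / real_complex R r = (complex.Re z / r +i* (complex.Im z / r))%C.
  rewrite -fmorphV; case: z => b c; by simpc.
apply: cvg_complex.
- apply: cvg_trans HR; apply: near_eq_cvg; near=> s.
  have sd : delta < s by near: s; exact: nbhs_right_gt.
  by rewrite numE // denE // quot.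
- apply: cvg_trans HI; apply: near_eq_cvg; near=> s.
  have sd : delta < s by near: s; exact: nbhs_right_gt.
  by rewrite numE // denE // quot.
Unshelve. all: by end_near. Qed.
End stationary.

Theorem mainTheorem9 (R : realType) (k : nat) (V : finType) (L : kgraph k V)
    (x : V -> R) (delta : R) :
  (0 < k)%N ->
  finite_kgraph L ->
  strongly_connected L ->
  perron_frobenius L x ->
  0 < delta < 1 ->
  is_weight (@w_delta R k V L x delta) ->
  (forall l : fin_path (kbratteli L),
      w_delta x delta l = diam (@d_delta R k V L x delta) l) ->
  zeta_regular (@d_delta R k V L x delta).
Proof.
move=> k_gt0 _ _ pf /andP[delta_gt0 _] ww wdiam.
exact: zeta_regular_stationary.
Qed.
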